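(* Let $M$ be any infinite Polish metric space (countable or uncountable), let $X=\prod_{-\infty}^{+\infty}M$ be endowed with any metric $d$ that is compatible with the product topology and for which the full-shift $T:X\to X$ is Lipschitz continuous, and let $\mathcal{M}(T)$ be the space of $T$-invariant Borel probability measures on $X$ with the weak topology. Then: 1. the set $\{\mu\in\mathcal{M}(T)\mid \dim_P(\mu)=+\infty\}$ is a dense $G_\delta$ subset of $\mathcal{M}(T)$; 2. the set $\{\mu\in\mathcal{M}(T)\mid \overline{R}(x)=+\infty \text{ for } \mu\text{-a.e. } x\in X\}$ is a dense $G_\delta$ subset of $\mathcal{M}(T)$; 3. the set $\{\mu\in\mathcal{M}(T)\mid \overline{R}(x,y)=+\infty \text{ for } (\mu\times\mu)\text{-a.e. } (x,y)\in X\times X\}$ is residual in $\mathcal{M}(T)$.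
   Context: A Polish metric space is a complete separable metric space. $X=\prod_{-\infty}^{+\infty}M=M^{\mathbb{Z}}$ is the bilateral product of copies of $M$, with its Borel $\sigma$-algebra $\mathcal{B}$. The full-shift $T:X\to X$ is $Tx=y$ with $y_i=x_{i-1}$ for each $i\in\mathbb{Z}$; it is a homeomorphism of $X$ onto itself. The weak topology on $\mathcal{M}(T)$ is the coarsest topology for which a net $\mu_\alpha\to\mu$ if and only if $\int f\,d\mu_\alpha\to\int f\,d\mu$ for every bounded continuous $f:X\to\mathbb{R}$. A subset of a topological space is residual if it contains a countable intersection of open dense sets. Packing dimension. For $\emptyset\neq E\subset X$ and $0<\delta<1$, a $\delta$-packing of $E$ is a countable collection of disjoint closed balls $\{B(x_k,r_k)\}_k$ with $x_k\in E$ and $0<r_k\le\delta/2$. For $\alpha>0$ set $P^\alpha_\delta(E)=\sup\{\sum_k(2r_k)^\alpha\mid \{B(x_k,r_k)\}_k \text{ is a } \delta\text{-packing of } E\}$, $P_0^\alpha(E)=\lim_{\delta\to0}P^\alpha_\delta(E)$ (both are $0$ for $E=\emptyset$), and $P^\alpha(E)=\inf\{\sum_kP_0^\alpha(E_k)\mid E\subset\bigcup_kE_k\}$, the infimum over all countable coverings of $E$. The packing dimension of $E$ is $\dim_P(E)=\inf\{\alpha>0\mid P^\alpha(E)=0\}\in[0,+\infty]$. For a Borel probability measure $\mu$, $\dim_P^-(\mu)=\inf\{\dim_P(E)\mid E\in\mathcal{B},\ \mu(E)>0\}$ and $\dim_P^+(\mu)=\inf\{\dim_P(E)\mid E\in\mathcal{B},\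 \mu(X\setminus E)=0\}$; if they coincide the common value is denoted $\dim_P(\mu)$ (so $\dim_P(\mu)=+\infty$ means that both are $+\infty$). Recurrence. With $\overline{B}(x,r)$ the closed ball and $\mathbb{N}=\{1,2,\dots\}$, for $x,y\in X$ and $r>0$ let $\tau_r(x)=\inf\{k\in\mathbb{N}\mid T^kx\in\overline{B}(x,r)\}$ and $\tau_r(x,y)=\inf\{k\in\mathbb{N}\mid T^kx\in\overline{B}(y,r)\}$ (possibly $+\infty$). The upper recurrence rate of $x$ is $\overline{R}(x)=\limsup_{r\to0}\frac{\log\tau_r(x)}{-\log r}$ and the upper quantitative waiting time indicator is $\overline{R}(x,y)=\limsup_{r\to0}\frac{\log\tau_r(x,y)}{-\log r}$. *)

(* Defs.v *)
From HB Require Import structures.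
From mathcomp Require Export all_boot all_order all_algebra.
From mathcomp Require Export all_classical all_reals all_analysis.
From mathcomp Require Export borel_hierarchy.

Set Implicit Arguments.
Unset Strict Implicit.
Unset Printing Implicit Defensive.

Import Order.TTheory GRing.Theory Num.Theory.
Import numFieldTopology.Exports numFieldNormedType.Exports.

Local Open Scope classical_set_scope.
Local Open Scope ring_scope.

#[short(type="completeMetricType")]
HB.structure Definition CompleteMetric (R : numDomainType) :=
  {M of Complete M & Metric R M}.

Definition separable (T : topologicalType) :=
  exists2 D : set T, countable D & dense D.

Definition residual (T : topologicalType) (S : set T) :=
  exists2 G : set T, Gdelta_dense G & G `<=` S.

(* [g_sigma_algebraType] forgets the topology of [X]; [borel X] and [X] are
   convertible types. *)
Definition borel (X : ptopologicalType) := g_sigma_algebraType (@open X).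

HB.instance Definition _ (X : ptopologicalType) :=
  Measurable.copy (borel X) (g_sigma_algebraType (@open X)).

Record compatible_metric (R : realType) (X : topologicalType)
    (d : X -> X -> R) : Prop := {
  compatible_metric_ge0 : forall x y, 0 <= d x y ;
  compatible_metric_eq0 : forall x y, d x y = 0 <-> x = y ;
  compatible_metric_sym : forall x y, d x y = d y x ;
  compatible_metric_triangle : forall x y z, d x z <= d x y + d y z ;
  compatible_metric_nbhs : forall x (A : set X),
    nbhs x A <-> exists2 e : R, 0 < e & [set y | d x y < e] `<=` A }.

Definition metric_lipschitz (R : realType) (X : Type) (d : X -> X -> R)
    (f : X -> X) :=
  exists L : R, forall x y, d (f x) (f y) <= L * d x y.

Definition mclosed_ball (R : realType) (X : Type) (d : X -> X -> R)
    (x : X) (r : R) : set X :=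
  [set y | d x y <= r].

Section packing_dimension.
Context (R : realType) (X : Type) (d : X -> X -> R).
Implicit Types (E : set X) (alpha delta : R).

(* A countable family of balls is indexed by a set [K] of natural numbers.
   [K] may be empty, so that both premeasures below vanish on the empty set;
   for nonempty [E] this does not change the supremum. *)
Definition is_packing delta E (K : set nat) (x : nat -> X) (r : nat -> R) :=
  (forall k, K k -> E (x k) /\ 0 < r k <= delta / 2) /\
  trivIset K (fun k => mclosed_ball d (x k) (r k)).

Definition packing_premeasure_delta alpha delta E : \bar R :=
  ereal_sup [set s | exists K x r, is_packing delta E K x r /\
    s = \esum_(k in K) ((2 * r k) `^ alpha)%:E].

Definition packing_premeasure alpha E : \bar R :=
  lim (packing_premeasure_delta alpha delta E @[delta --> 0^'+]).

Definition packing_measure alpha E : \bar R :=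
  ereal_inf [set (\sum_(0 <= k <oo) packing_premeasure alpha (F k))%E
            | F in [set F : (set X)^nat | E `<=` \bigcup_k F k]].

Definition packing_dim E : \bar R :=
  ereal_inf [set alpha%:E
            | alpha in [set alpha | 0 < alpha /\ packing_measure alpha E = 0%E]].

End packing_dimension.

Section packing_dimension_measure.
Context (R : realType) (X : ptopologicalType) (d : X -> X -> R).
Implicit Type mu : probability (borel X) R.

Definition lower_packing_dim mu : \bar R :=
  ereal_inf [set packing_dim d E
            | E in [set E : set (borel X) | measurable E /\ (0 < mu E)%E]].

Definition upper_packing_dim mu : \bar R :=
  ereal_inf [set packing_dim d E
            | E in [set E : set (borel X) | measurable E /\ mu (~` E) = 0%E]].

Definition has_packing_dim mu (s : \bar R) :=
  lower_packing_dim mu = s /\ upper_packing_dim mu = s.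

End packing_dimension_measure.

Section recurrence.
Context (R : realType) (X : Type) (d : X -> X -> R) (T : X -> X).
Local Open Scope ereal_scope.

Definition waiting_time (r : R) (x y : X) : \bar R :=
  ereal_inf [set k%:R%:E
            | k in [set k : nat | (0 < k)%N /\
                                  mclosed_ball d y r (iter k T x)]].

Definition return_time (r : R) (x : X) : \bar R := waiting_time r x x.

Definition upper_recurrence_rate (x : X) : \bar R :=
  limf_esup (fun r : R => lne (return_time r x) / (- ln r)%:E) 0^'+.

Definition upper_waiting_time_indicator (x y : X) : \bar R :=
  limf_esup (fun r : R => lne (waiting_time r x y) / (- ln r)%:E) 0^'+.

End recurrence.

Definition bilateral_product (M : Type) := int -> M.

HB.instance Definition _ (M : ptopologicalType) :=
  Topological.copy (bilateral_product M) {ptws int -> M}.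
HB.instance Definition _ (M : ptopologicalType) :=
  isPointed.Build (bilateral_product M) (fun=> point).

Definition full_shift (M : Type) (x : bilateral_product M)
  : bilateral_product M := fun i => x (i - 1).

Section weak_topology.
Context (R : realType) (X : ptopologicalType) (T : X -> X).

Definition invariant_measures : set (probability (borel X) R) :=
  [set mu | forall A : set (borel X), measurable A -> mu (T @^-1` A) = mu A].

Definition bounded_continuous : set (X -> R) :=
  [set f | continuous f /\ exists C : R, forall x, `|f x| <= C].

Definition integrals (mu : invariant_measures)
    : prod_topology (fun _ : bounded_continuous => R) :=
  fun f => \int[val mu]_x (val f x).

(* The initial topology of the family of all maps mu |-> \int f dmu, with [f]
   bounded and continuous. *)
Definition invariant_probability : Type := initial_topology integrals.

HB.instance Definition _ :=
  Topological.copy invariant_probability (initial_topology integrals).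

Definition prob_of (mu : invariant_probability) : probability (borel X) R :=
  val (mu : invariant_measures).

End weak_topology.

(* Main.v *)
Require Import Defs.
From mathcomp Require Import all_boot all_order all_algebra.
From mathcomp Require Import all_classical all_reals all_analysis.
From mathcomp Require Import measurable_realfun.
From mathcomp Require Import lra ring zify.
Import Order.TTheory GRing.Theory Num.Theory.
Import numFieldTopology.Exports numFieldNormedType.Exports.
Local Open Scope classical_set_scope.
Local Open Scope ring_scope.
Set Implicit Arguments.
Unset Strict Implicit.
Unset Printing Implicit Defensive.

(** Why the theorem holds. Call x an (a, m)-thick point of mu when the ball
B(x, 2^-n) has mu-mass at least 2^-(n a) for all n >= m. Packings of a thick
set have bounded sums, and a set without thick points can be covered
economically at one scale after another; hence dim_P(mu) is infinite exactly
when all sets of thick points are null ([has_packing_dim_pinftyP]). In the same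
way the recurrence rate is infinite almost everywhere exactly when, for all a
and m, the points that return to B(x, 2^-n) within time 2^(n a) for all n >= m
form a null set. These sets are closed, and the measures giving them mass
below e form an open set by the portmanteau theorem ([open_thick_lt],
[Gdelta_recurrence_pinfty]); this yields both G-delta statements. Infinite
packing dimension implies infinite waiting times by Fubini and invariance
([packing_pinfty_waiting]): if B(y, 2^-n) has mass below 2^-(n (a + 1)), the
points that reach it within 2^(n a) steps have mass below 2^-n. So the third
set contains the first one.

It remains to find, near any invariant mu, an invariant measure with both
properties. Let x have law mu and let an independent uniform number u provide a
random 2-adic integer, the phase, on which the shift acts as subtraction of 1.
Quantise the coordinates of x to a finite set F and overwrite some of them, at
very sparse positions determined by the phase, by letters outside of F, taken
from an infinite discrete sequence: these letters spell the phase in words of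
level j = 0, 1, 2, ..., level j revealing it modulo 2^(depth j). The resulting
process [coded] is stationary ([coded_law_invariant]), because truncating it to
finitely many levels leaves a function of x and of a uniform residue that the
shift permutes.

The metric d is only known to be compatible, but compactness of the sequences
over a finite alphabet gives a radius at which the letters of levels up to j are
recognised at coordinate 0 ([isolated_modulus]), and the Lipschitz constant
2^lam of the shift turns this into a radius 2^-(scale j) at which a whole
window of coordinates is read. This window consists of reach j positions and
enters the exponent as lam * reach j, so it is decisive that a word of that
length spells more than j * scale j bits ([scale_lt_depth]). This is possible
because M is infinite: the number of bits per letter is unbounded. Therefore, a
ball of radius 2^-(scale j) around a coded point has mass at most
2^-(depth j) < 2^-(j * scale j), and a return to it takes a time divisible by
2^(depth j) ([coded_close]). Both thick and quickly recurrent points are thus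
negligible. Finally, finer quantisations and sparser letters make the coded
process converge almost surely to x ([coded_cvg]). *)

(** * Metrics compatible with a topology *)

Definition countable_base (X : topologicalType) (C : nat -> set X) :=
  (forall k, open (C k)) /\
  forall x A, nbhs x A -> exists2 k, C k x & C k `<=` A.

Section compatible_metric_theory.
Context (R : realType) (X : topologicalType) (d : X -> X -> R).
Hypothesis dc : compatible_metric d.

Lemma cmetric_xx x : d x x = 0.
Proof. exact/(compatible_metric_eq0 dc). Qed.

Lemma cmetric_sym x y : d x y = d y x.
Proof. exact: compatible_metric_sym. Qed.

Lemma cmetric_ge0 x y : 0 <= d x y.
Proof. exact: compatible_metric_ge0. Qed.

Lemma cmetric_triangle y x z : d x z <= d x y + d y z.
Proof. exact: compatible_metric_triangle. Qed.

Lemma nbhs_cmetric_ball x e : 0 < e -> nbhs x [set y | d x y < e].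
Proof. by move=> e0; apply/(compatible_metric_nbhs dc); exists e. Qed.

Lemma continuous_cmetric y : continuous (fun x => d x y : R).
Proof.
move=> x A /= /nbhs_ballP[e /= e0 eA].
apply: filterS (nbhs_cmetric_ball x e0) => z /= xz; apply: eA => /=.
rewrite /ball /= ltr_distlC.
have := cmetric_triangle x z y; have := cmetric_triangle z x y.
rewrite (cmetric_sym z x); lra.
Qed.

Lemma closed_mclosed_ball x e : closed (mclosed_ball d x e).
Proof.
rewrite (_ : mclosed_ball _ _ _ = (d ^~ x) @^-1` [set t | t <= e]); last first.
  by apply/seteqP; split => y /=; rewrite /mclosed_ball/= cmetric_sym.
apply: preimage_closed => [y _|]; first exact: continuous_cmetric.
exact: closed_le.
Qed.

Lemma closed_cmetricP (C : set X) :
  (forall x, (forall e, 0 < e -> exists2 y, C y & d x y < e) -> C x) ->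
  closed C.
Proof.
move=> H x clx; apply: H => e e0.
by have [y [Cy xy]] := clx _ (nbhs_cmetric_ball x e0); exists y.
Qed.

End compatible_metric_theory.

(** * Borel maps and the weak topology *)

Section set_distance.
Context (R : realType) (X : topologicalType) (d : X -> X -> R).
Hypothesis dc : compatible_metric d.

(** The weak topology is defined by continuous functions only; the functions
min(1, n * set_dist A) increase to the indicator of the complement of a closed
set A and bring open sets into play. *)
Definition set_dist (A : set X) (x : X) : R := inf [set d x y | y in A].

Variable A : set X.
Hypothesis A0 : A !=set0.

Let has_inf_dist x : has_inf [set d x y | y in A].
Proof.
split; first by case: A0 => a Aa; exists (d x a); exists a.
by exists 0 => _ [y _ <-]; exact: (cmetric_ge0 dc).
Qed.

Lemma set_dist_ge0 x : 0 <= set_dist A x.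
Proof.
apply: lb_le_inf; first by case: (has_inf_dist x).
by move=> _ [y _ <-]; exact: (cmetric_ge0 dc).
Qed.

Lemma set_dist_le x y : A y -> set_dist A x <= d x y.
Proof. by move=> Ay; apply: ge_inf; [case: (has_inf_dist x)|exists y]. Qed.

Lemma set_dist_lip x z : set_dist A x <= d x z + set_dist A z.
Proof.
rewrite -lerBlDl; apply: lb_le_inf; first by case: (has_inf_dist z).
move=> _ [y Ay <-]; rewrite lerBlDl.
exact: le_trans (set_dist_le _ Ay) (cmetric_triangle dc _ _ _).
Qed.

Lemma set_dist_gt0 x : closed A -> ~ A x -> 0 < set_dist A x.
Proof.
move=> cA nAx; have /(compatible_metric_nbhs dc)[e e0 eA] : nbhs x (~` A).
  by apply: open_nbhs_nbhs; split => //; exact: closed_openC.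
apply: lt_le_trans e0 _; apply: lb_le_inf; first by case: (has_inf_dist x).
move=> _ [y Ay <-]; rewrite leNgt; apply/negP => xy.
exact: (eA y xy).
Qed.

Lemma continuous_set_dist : continuous (set_dist A : X -> R).
Proof.
move=> x B /= /nbhs_ballP[e /= e0 eB].
apply: filterS (nbhs_cmetric_ball dc x e0) => z /= xz; apply: eB => /=.
rewrite /ball /= ltr_distlC.
have := set_dist_lip x z; have := set_dist_lip z x.
rewrite (cmetric_sym dc z x); lra.
Qed.

End set_distance.

Section borel_maps.
Context (R : realType) (X : ptopologicalType).

Lemma borel_open (U : set X) : open U -> measurable (U : set (borel X)).
Proof. exact: (@sub_sigma_algebra X setT (@open X)). Qed.

Lemma borel_closed (U : set X) : closed U -> measurable (U : set (borel X)).
Proof.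
move=> cU; have /measurableC : measurable ((~` U : set X) : set (borel X)).
  by apply: borel_open; exact: closed_openC.
by rewrite setCK.
Qed.

Lemma borel_measurable_fun d (T : measurableType d) (f : T -> borel X) :
  (forall U : set X, open U -> measurable (f @^-1` U)) ->
  measurable_fun setT f.
Proof.
move=> H; apply: (@measurability _ _ T (borel X) _ _ (@open X)) => //.
by move=> _ [U oU <-]; rewrite setTI; exact: H.
Qed.

Lemma continuous_borel_measurable (f : X -> X) :
  continuous f -> measurable_fun setT (f : borel X -> borel X).
Proof.
move=> cf; apply: borel_measurable_fun => U oU.
by apply: borel_open; move/continuousP : cf; exact.
Qed.

Lemma continuous_measurable (f : X -> R) :
  continuous f -> measurable_fun setT (f : borel X -> R).
Proof.
move=> cf.
apply: (measurability _ (RGenOInfty.measurableE R)) => _ [_ [a ->] <-].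
rewrite setTI; apply: borel_open.
by move/continuousP : cf; apply; exact: interval_open.
Qed.

End borel_maps.

Section bounded_integrals.
Context (R : realType) d (T : measurableType d)
  (P : probability T R).

Lemma bounded_integrable (f : T -> R) (C : R) : measurable_fun setT f ->
  (forall x, `|f x| <= C) -> P.-integrable setT (EFin \o f).
Proof.
move=> mf fC; apply: measurable_bounded_integrable => //.
  by rewrite (le_lt_trans (probability_le1 P measurableT))// ltry.
exists C; split; first exact: num_real.
by move=> y Cy x _ /=; apply: le_trans (fC x) (ltW Cy).
Qed.

Lemma bounded_cvg_integral (f_ : nat -> T -> R) (f : T -> R) (C : R) :
  (forall n, measurable_fun setT (f_ n)) -> measurable_fun setT f ->
  (forall n x, `|f_ n x| <= C) ->
  {ae P, forall x, f_ ^~ x @ \oo --> f x} ->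
  (\int[P]_x f_ n x) @[n --> \oo] --> \int[P]_x f x.
Proof.
move=> mf_ mf fC cf.
have mE g : measurable_fun setT g -> measurable_fun setT (EFin \o g : T -> \bar R).
  by move=> mg; exact/measurable_EFinP.
have [|||fi _ H] := @dominated_convergence _ _ _ P setT measurableT
  (fun n => EFin \o f_ n) (EFin \o f) (EFin \o cst C) (fun n => mE _ (mf_ n)) (mE _ mf).
- apply: filterS cf => x h _; apply: cvg_EFin => //; exact: nearW.
- exact: finite_measure_integrable_cst.
- by apply: aeW => x n _ /=; rewrite lee_fin.
rewrite /Rintegral.
apply: fine_cvg; rewrite fineK//.
exact: integrable_fin_num fi.
Qed.

End bounded_integrals.

Section portmanteau.
Context (R : realType) (X : ptopologicalType) (d : X -> X -> R) (T : X -> X).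
Hypothesis dc : compatible_metric d.
Local Notation MT := (invariant_probability R T).

Lemma continuous_integral (f : X -> R) : @bounded_continuous R X f ->
  continuous (fun mu : MT => \int[prob_of mu]_x f x : R).
Proof.
move=> bf mu; pose g : @bounded_continuous R X := exist _ f (mem_set bf).
apply: (@continuous_comp MT (prod_topology (fun _ : @bounded_continuous R X => R)) R
  (@integrals R X T) (@^~ g)).
  exact: (@initial_continuous _ _ (@integrals R X T)).
exact: (@proj_continuous _ (fun _ : @bounded_continuous R X => R) g).
Qed.

(** By dominated convergence mu U is a supremum of integrals of continuous
functions below the indicator of U, each of which is continuous in mu. *)
Lemma portmanteau_open (U : set X) (c : R) : open U ->
  open [set mu : MT | (c%:E < prob_of mu U)%E].
Proof.
move=> oU; have mU := borel_open oU.
have [U0|/set0P U0] := eqVneq (~` U) set0.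
  have -> : U = setT by rewrite -(setCK U) U0 setC0.
  rewrite (_ : [set mu | _] = if c < 1 then setT else set0).
    by case: ifP => _; [exact: openT|exact: open0].
  apply/seteqP; split => mu /=; rewrite probability_setT lte_fin; case: ifP => //.
have cU : closed (~` U) by exact: open_closedC.
pose f n (x : X) : R := Num.min 1 (n%:R * set_dist d (~` U) x).
have f0 n x : 0 <= f n x.
  by rewrite le_min ler01 mulr_ge0// set_dist_ge0.
have f1 n x : f n x <= 1 by rewrite ge_min lexx.
have cf n : continuous (f n).
  move=> x.
  apply: (@continuous_min R X (fun=> 1) (fun x => n%:R * set_dist d (~` U) x) x).
    exact: cst_continuous.
  apply: continuousM; first exact: cst_continuous.
  exact: continuous_set_dist.
have bf n : @bounded_continuous R X (f n).
  by split; [exact: cf|exists 1 => x; rewrite ger0_norm].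
have fU n x : f n x <= \1_U x.
  rewrite indicE; case: (boolP (x \in U)) => //=.
  rewrite notin_setE => nUx; rewrite ge_min; apply/orP; right.
  have := set_dist_le dc U0 x nUx; rewrite (cmetric_xx dc) => sd.
  by rewrite mulr_ge0_le0.
have fcvg x : f ^~ x @ \oo --> (\1_U x : R).
  rewrite indicE; have [|] := boolP (x \in U); rewrite ?inE ?notin_setE => Ux.
    have sd : 0 < set_dist d (~` U) x by apply: (set_dist_gt0 dc U0) => //; exact.
    apply/cvgrPdist_le => e e0; near=> n.
    rewrite /f (_ : Num.min _ _ = 1) ?subrr ?normr0 ?ltW//.
    apply/min_idPl; rewrite -ler_pdivrMr//.
    by near: n; exact: nbhs_infty_ger.
  rewrite (_ : (f^~ x) = cst 0); first exact: cvg_cst.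
  apply/funext => n /=; apply/eqP; rewrite eq_le f0 andbT.
  by have := fU n x; rewrite indicE memNset.
rewrite openE => mu /= cmu.
have muU : (\int[prob_of mu]_x \1_U x)%R = fine (prob_of mu U).
  by rewrite /Rintegral integral_indic// setIT.
have muUf : (fine (prob_of mu U))%:E = prob_of mu U.
  by rewrite fineK// fin_num_measure.
have cvgi : (\int[prob_of mu]_x f n x)%R @[n --> \oo] --> fine (prob_of mu U).
  rewrite -muU; apply: (@bounded_cvg_integral _ _ _ _ _ _ 1).
  - by move=> n; exact: continuous_measurable.
  - exact: measurable_indic.
  - by move=> n x; rewrite ger0_norm.
  - exact: aeW.
have [n nc] : exists n, c < \int[prob_of mu]_x f n x.
  have : \forall n \near \oo, c < \int[prob_of mu]_x f n x.
    by apply: (cvgr_gt _ cvgi); rewrite -lte_fin muUf.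
  by case=> n _ /(_ n (leqnn n)); exists n.
have : nbhs mu [set nu : MT | c < \int[prob_of nu]_x f n x].
  apply: open_nbhs_nbhs; split => //.
  by move/continuousP : (continuous_integral (bf n)) => /(_ _ (@open_gt _ c)).
apply: filterS => nu /= cnu.
rewrite -lte_fin in cnu; apply: lt_le_trans cnu _.
have nuUf : (fine (prob_of nu U))%:E = prob_of nu U.
  by rewrite fineK// fin_num_measure.
rewrite -nuUf lee_fin.
have -> : fine (prob_of nu U) = (\int[prob_of nu]_x \1_U x)%R.
  by rewrite /Rintegral integral_indic// setIT.
apply: le_Rintegral => //.
- apply: (@bounded_integrable _ _ _ _ _ 1); first exact: continuous_measurable.
  by move=> x; rewrite ger0_norm.
- apply: (@bounded_integrable _ _ _ _ _ 1); first exact: measurable_indic.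
  by move=> x; rewrite indicE; case: (_ \in _); rewrite ?normr1 ?normr0.
Unshelve. all: by end_near. Qed.

Lemma portmanteau_closed (C : set X) (c : R) : closed C ->
  open [set mu : MT | (prob_of mu C < c%:E)%E].
Proof.
move=> cC; rewrite (_ : [set mu | _] = [set mu : MT | ((1 - c)%:E < prob_of mu (~` C))%E]).
  by apply: portmanteau_open; exact: closed_openC.
apply/seteqP; split => mu /=; have mC := borel_closed cC;
  rewrite probability_setC//.
  rewrite -(@fineK _ (prob_of mu C)) ?fin_num_measure// -EFinB !lte_fin; lra.
rewrite -(@fineK _ (prob_of mu C)) ?fin_num_measure// -EFinB !lte_fin; lra.
Qed.

(** The weak topology is initial for the integrals, so a sequence converges as
soon as all its integrals do. *)
Lemma weak_limit_closure (S : set MT) (mu : MT) (nu : nat -> MT) :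
  (forall n, S (nu n)) ->
  (forall f, @bounded_continuous R X f ->
    (\int[prob_of (nu n)]_x f x) @[n --> \oo] --> \int[prob_of mu]_x f x) ->
  closure S mu.
Proof.
move=> Snu cnu; suff: nu @ \oo --> mu.
  by move=> H B /H [n _ /(_ n (leqnn n)) nB]; exists (nu n); split => //; exact: Snu.
suff H : integrals (nu n) @[n --> \oo] --> integrals mu.
  move=> A; rewrite nbhsE => -[B [[C oC CB] Bmu] BA].
  apply: filterS BA _; rewrite -CB.
  by apply: H; apply: open_nbhs_nbhs; split => //; move: Bmu; rewrite -CB.
apply/cvg_sup => g; apply/cvg_image.
  by rewrite predeqE => r; split => // _; exists (fun=> r).
have := cnu (val g) (set_mem (valP g)).
move=> H A /H [N _ HN].
exists ([set h : prod_topology (fun _ : @bounded_continuous R X => R) | A (h g)]).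
  by exists N.
by apply/seteqP; split => [r [h hA <-]//|r Ar]; exists (fun=> r).
Qed.

End portmanteau.

(** * Dyadic radii and thick points *)

Section dyadic_radii.
Context (R : realType).

Definition hpow (n : nat) : R := 2^-1 ^+ n.

Lemma hpow_gt0 n : 0 < hpow n.
Proof. by rewrite /hpow exprn_gt0// invr_gt0. Qed.

Lemma hpow_ge0 n : 0 <= hpow n.
Proof. exact: ltW (hpow_gt0 n). Qed.

Lemma hpowS n : hpow n = 2 * hpow n.+1.
Proof. by rewrite /hpow exprS mulrA divff ?mul1r. Qed.

Lemma hpowD n m : hpow (n + m) = hpow n * hpow m.
Proof. by rewrite /hpow exprD. Qed.

Lemma hpowM n m : hpow (n * m) = hpow n ^+ m.
Proof. by rewrite /hpow exprM. Qed.

Lemma ler_hpow n m : (hpow n <= hpow m) = (m <= n)%N.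
Proof. by rewrite /hpow ler_iXn2l// ?invr_gt0// invf_lt1 ?ltr1n. Qed.

Lemma hpow_le1 n : hpow n <= 1.
Proof. by rewrite (_ : 1 = hpow 0) ?ler_hpow// /hpow expr0. Qed.

Lemma cvg_hpow : hpow n @[n --> \oo] --> (0 : R).
Proof. by apply: cvg_expr; rewrite ger0_norm ?invr_ge0// invf_lt1 ?ltr1n. Qed.

Lemma ex_hpow_lt e m : 0 < e -> exists2 n, (m <= n)%N & hpow n < e.
Proof.
move=> e0; have : \forall n \near \oo, hpow n < e.
  exact: (cvgr_lt _ cvg_hpow).
case=> N _ HN; exists (maxn m N); first exact: leq_maxl.
by apply: HN => /=; exact: leq_maxr.
Qed.

Lemma hpow_bracket r m : 0 < r -> r <= hpow m ->
  exists2 n, (m <= n)%N & hpow n.+1 < r <= hpow n.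
Proof.
move=> r0 rm; have ex : exists n, hpow n.+1 < r.
  by have [n _ nr] := ex_hpow_lt 1 r0; exists n; apply: le_lt_trans nr; rewrite ler_hpow.
case: (ex_minnP ex) => n nr nmin; exists n.
  rewrite leqNgt; apply/negP => nm.
  have : hpow m < r by apply: le_lt_trans nr; rewrite ler_hpow.
  by rewrite ltNge rm.
rewrite nr /= leNgt; apply/negP => rn.
case: n nr nmin rn => [|n] nr nmin rn.
  by move: rm; rewrite leNgt (le_lt_trans _ rn)// ler_hpow.
by have := nmin n rn; rewrite ltnn.
Qed.

End dyadic_radii.
Arguments hpow {R} n.

Section thick_points.
Context (R : realType) (X : ptopologicalType) (d : X -> X -> R).
Hypothesis dc : compatible_metric d.

(** The upper local dimension of mu at such a point is at most a; the uniform
threshold m makes the set closed. *)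
Definition thick (mu : set X -> \bar R) (a m : nat) : set X :=
  [set x | forall n, (m <= n)%N ->
    ((hpow (n * a))%:E <= mu (mclosed_ball d x (hpow n)))%E].

Lemma measurable_mclosed_ball x r :
  measurable (mclosed_ball d x r : set (borel X)).
Proof. by apply: (@borel_closed X); exact: closed_mclosed_ball. Qed.

(** Continuity of mu from above along closed balls. *)
Lemma mclosed_ball_shrink (mu : probability (borel X) R) x (r c : R) :
  (mu (mclosed_ball d x r) < c%:E)%E ->
  exists2 e, 0 < e & (mu (mclosed_ball d x (r + e)) < c%:E)%E.
Proof.
move=> muc; pose F n : set (borel X) := mclosed_ball d x (r + hpow n).
have FE : \bigcap_n F n = mclosed_ball d x r.
  apply/seteqP; split => y /= H; last first.
    by move=> n _; apply: le_trans H _; rewrite lerDl hpow_ge0.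
  apply/ler_addgt0Pr => e e0.
  have [n _ ne] := ex_hpow_lt 0 e0.
  apply: le_trans (H n I) _; rewrite lerD2l; exact: ltW.
have mF n : measurable (F n) by exact: measurable_mclosed_ball.
have cF : mu (F n) @[n --> \oo] --> mu (mclosed_ball d x r).
  rewrite -FE; apply: nonincreasing_cvg_mu => //.
  - by rewrite (le_lt_trans (probability_le1 mu (mF 0%N)))// ltry.
  - exact: bigcapT_measurable.
  - move=> n m nm; apply/subsetPset => y /=.
    by rewrite /F /mclosed_ball/= => /le_trans; apply; rewrite lerD2l ler_hpow.
have : \forall n \near \oo, (mu (F n) < c%:E)%E.
  by apply: (cF [set t | (t < c%:E)%E]); apply: open_nbhs_nbhs; split => //; exact: open_ereal_lt_ereal.
case=> n _ /(_ n (leqnn n)) /= H; exists (hpow n) => //; exact: hpow_gt0.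
Qed.

Lemma mclosed_ballS x y r e : d x y <= e ->
  mclosed_ball d y r `<=` mclosed_ball d x (r + e).
Proof.
move=> xy z /= yz; rewrite /mclosed_ball/= addrC.
by apply: le_trans (cmetric_triangle dc y x z) _; exact: lerD.
Qed.

(** A strict bound on the mass of a ball survives a slight enlargement, hence a
slight move of the centre. *)
Lemma closed_thick (mu : probability (borel X) R) a m : closed (thick mu a m).
Proof.
apply: (closed_cmetricP dc) => x H n mn; rewrite leNgt; apply/negP.
move=> /mclosed_ball_shrink[e e0 lte].
have [y yt xy] := H _ e0.
have := yt _ mn; rewrite leNgt => /negP; apply; apply: le_lt_trans lte.
apply: le_measure; rewrite ?inE; try exact: measurable_mclosed_ball.
by apply: mclosed_ballS; exact: ltW.
Qed.

Variable C : nat -> set X.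
Hypothesis Cb : countable_base C.

(** Thickness depends on the measure, so the portmanteau theorem does not apply
to the set itself. However, a point that is not thick for mu has a basic
neighbourhood without thick points of nu, for all nu near mu. Finitely many
of these neighbourhoods carry mu-mass above 1 - e, and so does every nu near mu
since their union is open. *)
Lemma open_thick_lt (T : X -> X) a m (e : R) :
  open [set mu : invariant_probability R T |
    (prob_of mu (thick (prob_of mu) a m) < e%:E)%E].
Proof.
rewrite openE => mu /= mue; set A := thick _ _ _ in mue.
pose good k := exists2 W, nbhs mu W & forall nu, W nu ->
  C k `&` thick (prob_of nu) a m = set0.
pose D k : set X := if pselect (good k) then C k else set0.
have oD k : open (D k).
  by rewrite /D; case: pselect => ?; [exact: Cb.1|exact: open0].
have AD : ~` A `<=` \bigcup_k D k.
  move=> x /= /existsNP[n /not_implyP[mn /negP]]; rewrite -ltNge => H.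
  have [e' e'0 H'] := mclosed_ball_shrink H.
  have [k Ckx Ck] := Cb.2 _ _ (nbhs_cmetric_ball dc x e'0).
  exists k => //; rewrite /D; case: pselect => //= -[].
  exists [set nu | (prob_of nu (mclosed_ball d x (hpow n + e')) < (hpow (n * a))%:E)%E].
    apply: open_nbhs_nbhs; split => //.
    by apply: (@portmanteau_closed R X d T dc); exact: closed_mclosed_ball.
  move=> nu /= nuW; rewrite -subset0 => y [Cy /(_ _ mn)].
  rewrite leNgt => /negP; apply; apply: le_lt_trans nuW.
  apply: le_measure; rewrite ?inE; try exact: measurable_mclosed_ball.
  by apply: mclosed_ballS; exact: ltW (Ck _ Cy).
pose E n : set (borel X) := \bigcup_(k < n) D k.
have mE n : measurable (E n).
  by apply: (@borel_open X); apply: bigcup_open.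
have mbE : measurable (\bigcup_n E n) by exact: bigcupT_measurable.
have cE : prob_of mu (E n) @[n --> \oo] --> prob_of mu (\bigcup_n E n).
  apply: nondecreasing_cvg_mu => //.
  move=> i j ij; apply/subsetPset; apply: bigcup_sub => k /= ki.
  by apply: bigcup_sup => /=; exact: leq_trans ki ij.
have mA : measurable (A : set (borel X)) by apply: (@borel_closed X); exact: closed_thick.
have lt1 : ((1 - e)%:E < prob_of mu (\bigcup_n E n))%E.
  apply: (@lt_le_trans _ _ (prob_of mu (~` A))).
    rewrite probability_setC// -(@fineK _ (prob_of mu A)) ?fin_num_measure// -EFinB.
    move: mue; rewrite -(@fineK _ (prob_of mu A)) ?fin_num_measure// !lte_fin; lra.
  apply: le_measure; rewrite ?inE//; first exact: measurableC.
  move=> x /AD[k _ Dk]; exists k.+1 => //; exists k => //=.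
have : \forall n \near \oo, ((1 - e)%:E < prob_of mu (E n))%E.
  by apply: (cE [set t | ((1 - e)%:E < t)%E]); apply: open_nbhs_nbhs; split => //; exact: open_ereal_gt_ereal.
case=> n _ /(_ n (leqnn n)) /= En.
have W k : exists2 W, nbhs mu W & forall nu, W nu ->
    D k `&` thick (prob_of nu) a m = set0.
  rewrite /D; case: pselect => // ?; exists setT; first exact: filterT.
  by move=> nu _; rewrite set0I.
pose WW k := projT1 (cid2 (W k)).
have nWW : nbhs mu [set nu | forall k : 'I_n, WW k nu].
  have H (k : 'I_n) : nbhs mu (WW k) by rewrite /WW; case: cid2.
  exact: (@filter_forall _ _ (fun k : 'I_n => WW k) (nbhs mu) (nbhs_filter mu) H).
have nE : nbhs mu [set nu : invariant_probability R T | ((1 - e)%:E < prob_of nu (E n))%E].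
  apply: open_nbhs_nbhs; split => //.
  by apply: (@portmanteau_open R X d T dc); apply: bigcup_open.
apply: filterS2 nWW nE => nu /= nW nuE.
have mAn : measurable (thick (prob_of nu) a m : set (borel X)).
  by apply: (@borel_closed X); exact: closed_thick.
have : (prob_of nu (thick (prob_of nu) a m) <= prob_of nu (~` E n))%E.
  apply: le_measure; rewrite ?inE//; first exact: measurableC.
  move=> x xt [k kn Dk].
  have : D k `&` thick (prob_of nu) a m = set0.
    by have := nW (Ordinal kn); rewrite /WW; case: cid2 => /= V _ H /H.
  by rewrite -subset0 => /(_ x); apply.
move=> /le_lt_trans; apply; rewrite probability_setC//.
move: nuE; rewrite -(@fineK _ (prob_of nu (E n))) ?fin_num_measure// -EFinB !lte_fin; lra.
Qed.

End thick_points.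

(** * Packing dimension of a measure *)

Section packing_premeasure_theory.
Context (R : realType) (X : pointedType) (d : X -> X -> R).
Local Open Scope ereal_scope.
Implicit Types (E : set X) (a e : R).

Lemma packing_premeasure_delta_ge0 a e E : 0 <= packing_premeasure_delta d a e E.
Proof.
apply: le_ereal_sup_tmp; exists 0 => //.
exists set0, (fun=> point), (fun=> 1%R); rewrite esum_set0; split => //.
by split => // i j [].
Qed.

Lemma packing_premeasure_delta_le a E e e' : (e <= e')%R ->
  packing_premeasure_delta d a e E <= packing_premeasure_delta d a e' E.
Proof.
move=> ee'; apply: ereal_sup_le => _ [K [x [r [[H1 H2] ->]]]].
exists K, x, r; split => //; split => // k Kk.
have [Ex /andP[r0 re]] := H1 k Kk; split => //; rewrite r0 /=.
by apply: le_trans re _; rewrite ler_pM2r// invr_gt0.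
Qed.

Lemma packing_premeasureE a E : packing_premeasure d a E =
  ereal_inf [set packing_premeasure_delta d a e E | e in [set e | (0 < e)%R]].
Proof.
rewrite /packing_premeasure.
have nd : {in `]0%R, +oo[ &, nondecreasing_fun
    (fun e => packing_premeasure_delta d a e E)}.
  by move=> u v _ _ uv; exact: packing_premeasure_delta_le.
have := @nondecreasing_at_right_cvge R
  (fun e => packing_premeasure_delta d a e E) 0%R +oo%O isT nd.
move/cvg_lim => -> //; congr ereal_inf.
apply/seteqP; split => [_ [e /= e0 <-]|_ [e /= e0 <-]].
  by exists e => //; move: e0; rewrite /= in_itv/= andbT.
by exists e => //; rewrite /= in_itv/= andbT.
Qed.

Lemma packing_premeasure_ge0 a E : 0 <= packing_premeasure d a E.
Proof.
rewrite packing_premeasureE; apply: le_ereal_inf_tmp => _ [e _ <-].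
exact: packing_premeasure_delta_ge0.
Qed.

Lemma packing_premeasure0 a : packing_premeasure d a set0 = 0.
Proof.
apply/eqP; rewrite eq_le packing_premeasure_ge0 andbT packing_premeasureE.
apply: (@le_trans _ _ (packing_premeasure_delta d a 1%R set0)).
  by apply: ereal_inf_lbound; exists 1%R => //=.
apply: ge_ereal_sup => _ [K [x [r [[H _] ->]]]].
rewrite (_ : K = set0) ?esum_set0//.
by rewrite -subset0 => k /H[].
Qed.

Lemma packing_measure_ge0 a E : 0 <= packing_measure d a E.
Proof.
apply: le_ereal_inf_tmp => _ [F _ <-]; apply: nneseries_ge0 => k _ _.
exact: packing_premeasure_ge0.
Qed.

Lemma packing_measure_le a E : packing_measure d a E <= packing_premeasure d a E.
Proof.
pose F k := if k == 0%N then E else set0.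
apply: (@le_trans _ _ (\sum_(0 <= k <oo) packing_premeasure d a (F k))).
  by apply: ereal_inf_lbound; exists F => // x Ex; exists 0%N.
rewrite (@nneseries_split _ (fun k => packing_premeasure d a (F k)) 0%N 1%N); last first.
  by move=> k _; exact: packing_premeasure_ge0.
rewrite add0n big_nat1 eseries0 ?adde0// => k k1 _.
by rewrite /F gtn_eqF ?packing_premeasure0.
Qed.

End packing_premeasure_theory.

Section packing_dimension_thick.
Context (R : realType) (X : ptopologicalType) (d : X -> X -> R).
Hypothesis dc : compatible_metric d.
Implicit Type mu : probability (borel X) R.

Lemma esum_disjoint_le mu (K : set nat) (F : nat -> set X) (f : nat -> \bar R) (e : R) :
  (0 <= e)%R ->
  (forall k, K k -> measurable (F k : set (borel X))) -> trivIset K F ->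
  (forall k, K k -> (f k <= e%:E * mu (F k))%E) ->
  (\esum_(k in K) f k <= e%:E)%E.
Proof.
move=> e0 mF tF fF; apply: ge_ereal_sup => _ [A [fA AK] <-].
have mFA k : A k -> measurable (F k : set (borel X)) by move/AK; exact: mF.
apply: (@le_trans _ _ (\sum_(k \in A) e%:E * mu (F k))%E).
  by apply: lee_fsum => // k Ak; apply: fF; exact: AK.
rewrite -ge0_mule_fsumr//.
rewrite -(@measure_fin_bigcup _ _ _ mu nat A (F : nat -> set (borel X)))//; last first.
  exact: sub_trivIset tF.
rewrite -[leRHS]mule1; apply: lee_wpmul2l; first by rewrite lee_fin.
by apply: probability_le1; apply: fin_bigcup_measurable.
Qed.

(** Disjoint balls centred at thick points have mass at least of order (2 r)^a,
so their sum of (2 r)^(a + 1) is at most the supremum of 2 r, up to a constant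
factor. *)
Lemma packing_dim_thick mu a m :
  (packing_dim d (thick d mu a m) <= a.+1%:R%:E)%E.
Proof.
set A := thick _ _ _ _.
have mB x r : measurable (mclosed_ball d x r : set (borel X)).
  exact: measurable_mclosed_ball.
apply: ereal_inf_lbound; exists a.+1%:R => //; split => //.
apply/eqP; rewrite eq_le packing_measure_ge0 andbT.
apply: le_trans (packing_measure_le _ _ _) _.
apply/lee_addgt0Pr => e e0; rewrite add0e packing_premeasureE.
(* If 2^-(n + 1) < r <= 2^-n then 2 r <= 4 * 2^-(n + 1), which costs a factor
   4^a against the mass of the ball; one factor 2 r <= del pays for it. *)
pose del : R := Num.min (hpow m) (e / 4 ^+ a).
have del0 : 0 < del by rewrite lt_min hpow_gt0 divr_gt0// exprn_gt0.
apply: (@le_trans _ _ (packing_premeasure_delta d a.+1%:R del A)).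
  by apply: ereal_inf_lbound; exists del.
apply: ge_ereal_sup => _ [K [x [r [[H1 H2] ->]]]].
apply: (@esum_disjoint_le mu K (fun k => mclosed_ball d (x k) (r k))) => //.
  exact: ltW.
move=> k /H1[Ax /andP[r0 rdel]].
  have rm : r k <= hpow m.
    apply: le_trans rdel _; rewrite ler_pdivrMr// (@le_trans _ _ (hpow m))//.
      by rewrite ge_min lexx.
    by rewrite ler_peMr ?hpow_ge0// ler1n.
  have [n mn /andP[nr rn]] := hpow_bracket r0 rm.
  have /Ax : (m <= n.+1)%N by exact: leq_trans mn _.
  move=> H.
  have {}H : ((hpow (n.+1 * a))%:E <= mu (mclosed_ball d (x k) (r k)))%E.
    apply: le_trans H _; apply: le_measure; rewrite ?inE// => y /=.
    by rewrite /mclosed_ball/= => /le_trans; apply; exact: ltW.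
  rewrite powR_mulrn; last by rewrite mulr_ge0// ltW.
  apply: (@le_trans _ _ (e%:E * (hpow (n.+1 * a))%:E)%E); last first.
    by apply: lee_wpmul2l => //; rewrite lee_fin ltW.
  rewrite -EFinM lee_fin exprS hpowM.
  have -> : e = (e / 4 ^+ a) * 4 ^+ a by rewrite divfK// expf_neq0.
  rewrite -[leRHS]mulrA -exprMn; apply: ler_pM.
  - by rewrite mulr_ge0// ltW.
  - by rewrite exprn_ge0// mulr_ge0// ltW.
  - rewrite mulrC -ler_pdivlMr//; apply: le_trans rdel _.
    by rewrite ler_pM2r// ge_min lexx orbT.
  - apply: lerXn2r; rewrite ?nnegrE.
    + by rewrite mulr_ge0// ltW.
    + by rewrite mulr_ge0// hpow_ge0.
    + by move: rn; rewrite hpowS; lra.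
Qed.

Variable C : nat -> set X.
Hypothesis Cb : countable_base C.

(** A maximal disjoint family exists by Zorn, and doubling its balls covers F.
It is countable, and can be indexed by natural numbers, because each ball
contains a basic open set around its centre. *)
Lemma maximal_packing (F : set X) (r : R) : 0 < r ->
  exists (K : set nat) (x : nat -> X), [/\ forall k, K k -> F (x k),
    trivIset K (fun k => mclosed_ball d (x k) r) &
    F `<=` \bigcup_(k in K) mclosed_ball d (x k) (2 * r)].
Proof.
move=> r0; pose B x := mclosed_ball d x r.
have Bxx x : B x x by rewrite /B /mclosed_ball/= (cmetric_xx dc) ltW.
pose P (S : set X) := S `<=` F /\
  forall s t, S s -> S t -> B s `&` B t !=set0 -> s = t.
have [S [[SF Sdis] Smax]] : exists S, P S /\ forall S', S `<` S' -> ~ P S'.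
  apply: Zorn_bigcup => G GP Gtot; split.
    by move=> s [S GS Ss]; exact: (GP _ GS).1.
  move=> s t [S GS Ss] [S' GS' S't] st.
  have [SS'|S'S] := Gtot _ _ GS GS'.
    exact: (GP _ GS').2 _ _ (SS' _ Ss) S't st.
  exact: (GP _ GS).2 _ _ Ss (S'S _ S't) st.
have /choice[ka kaP] : forall s, exists k, C k s /\ C k `<=` B s.
  move=> s; have [k Cks Ck] := Cb.2 _ _ (nbhs_cmetric_ball dc s r0).
  by exists k; split => // y /Ck /= /ltW.
pose x k := xget point [set s | S s /\ ka s = k].
have xP k : (ka @` S) k -> S (x k) /\ ka (x k) = k.
  by move=> [s Ss sk]; exact: (@xgetPex _ point [set s | S s /\ ka s = k]) (ex_intro _ s (conj Ss sk)).
exists (ka @` S), x; split.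
- by move=> k /xP[/SF].
- move=> i j /xP[Si xi] /xP[Sj xj] ij.
  by rewrite -xi -xj; congr ka; exact: Sdis ij.
move=> y Fy; apply: contrapT => ny.
have nS s : S s -> B s `&` B y = set0.
  move=> Ss; rewrite -subset0 => z [sz yz]; apply: ny.
  exists (ka s); first by exists s.
  have -> : x (ka s) = s.
    have [Sx xs] := xP (ka s) (ex_intro2 _ _ s Ss erefl).
    apply: Sdis => //; exists s; split => //.
    by have := (kaP (x (ka s))).2; rewrite xs; apply; exact: (kaP s).1.
  rewrite /mclosed_ball/=; apply: le_trans (cmetric_triangle dc z s y) _.
  by rewrite (cmetric_sym dc z) mulr_natl mulr2n; exact: lerD.
have [Sy|nSy] := pselect (S y).
  by have := nS _ Sy; rewrite setIid -subset0 => /(_ y); apply.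
apply: (Smax (S `|` [set y])).
  by split; [exact: subsetUl|move=> /(_ y (or_intror erefl))].
split; first by move=> s [/SF//|->].
move=> s t [Ss|->] [St|->] // [z].
- by move=> [sz tz]; apply: Sdis => //; exists z.
- by rewrite nS.
- by rewrite setIC nS.
Qed.

Lemma measure_bigcup_le_esum mu (K : set nat) (G : nat -> set X) (c : R) (w : nat -> R) :
  (0 <= c)%R -> (forall k, 0 <= w k)%R ->
  (forall k, measurable (G k : set (borel X))) ->
  (forall k, K k -> (mu (G k) <= (c * w k)%:E)%E) ->
  (mu (\bigcup_(k in K) G k) <= c%:E * \esum_(k in K) (w k)%:E)%E.
Proof.
move=> c0 w0 mG GK; pose H k : set (borel X) := if k \in K then G k else set0.
have mH k : measurable (H k) by rewrite /H; case: ifP.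
have -> : \bigcup_(k in K) G k = \bigcup_k H k by rewrite bigcup_mkcond.
have mbH : measurable (\bigcup_k H k) by exact: bigcupT_measurable.
apply: (@le_trans _ _ (\sum_(0 <= k <oo) mu (H k))%E).
  exact: measure_sigma_subadditive.
have -> : K = [set k | k \in K] by apply/seteqP; split => k /=; rewrite ?inE.
rewrite -(@nneseries_esum R (fun k => (w k)%:E) (mem K)); last first.
  by move=> k _; rewrite lee_fin.
rewrite -nneseriesZl//; last by move=> k _; rewrite lee_fin.
rewrite [leRHS]eseries_mkcond; apply: lee_nneseries => // k _.
rewrite /H -[mem K k]/(k \in K); case: ifPn => [/set_mem /GK|_]; last by rewrite measure0.
by rewrite -EFinM.
Qed.

(** Each point of E has, at some scale n, a ball of mass below 2^-(n (a + 1)).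
The points with the same n are covered by doubling a maximal packing with balls
of radius 2^-(n + 1), whose mass is thus at most 2^-n times a packing sum; the
factors 2^-n are summable. *)
Lemma packing_measure_thin mu a (alpha : R) (E : set X) :
  0 < alpha -> alpha <= a%:R -> measurable (E : set (borel X)) ->
  (forall m x, E x -> ~ thick d mu a.+1 m x) ->
  (mu E <= packing_measure d alpha E)%E.
Proof.
move=> al0 ala mE Ethin; apply: le_ereal_inf_tmp => _ [F EF <-].
have mB x r : measurable (mclosed_ball d x r : set (borel X)).
  exact: measurable_mclosed_ball.
have cover G e : 0 < e -> exists2 U : set (borel X), measurable U /\ G `&` E `<=` U &
    (mu U <= packing_premeasure_delta d alpha e G)%E.
  move=> e0; set s := packing_premeasure_delta _ _ _ _.
  have s0 : (0 <= s)%E by exact: packing_premeasure_delta_ge0.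
  have [soo|sfin] := eqVneq s +oo%E.
    by exists setT; [split => //|rewrite soo leey].
  have {}sfin : s \is a fin_num by rewrite ge0_fin_numE// lt_neqAle sfin leey.
  have [n0 n01 n0e] := ex_hpow_lt 1 e0.
  pose Fn n := [set x | (G `&` E) x /\
    (mu (mclosed_ball d x (hpow n)) < (hpow (n * a.+1))%:E)%E].
  have /choice[U UP] : forall n, exists U : set (borel X),
      [/\ measurable U, Fn (n0 + n)%N `<=` U & (mu U <= (hpow (n0 + n))%:E * s)%E].
    move=> i; set n := (n0 + i)%N.
    have [K [x [Kx tK FK]]] := maximal_packing (Fn n) (hpow_gt0 R n.+1).
    rewrite -hpowS in FK.
    exists (\bigcup_(k in K) mclosed_ball d (x k) (hpow n)); split => //.
      exact: bigcup_measurable.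
    apply: (@le_trans _ _ ((hpow n)%:E * \esum_(k in K) (hpow n `^ alpha)%:E)%E).
      apply: (@measure_bigcup_le_esum mu K (fun k => mclosed_ball d (x k) (hpow n)) _ (fun=> hpow n `^ alpha)) => //.
      - exact: hpow_ge0.
      - by move=> k; exact: powR_ge0.
      - move=> k /Kx[_ /ltW] /le_trans; apply.
        rewrite lee_fin hpowM exprS ler_wpM2l ?hpow_ge0//.
        rewrite -powR_mulrn ?hpow_ge0// ger_powR//.
        by rewrite hpow_gt0 hpow_le1.
    apply: lee_wpmul2l; first by rewrite lee_fin hpow_ge0.
    apply: ereal_sup_ubound; exists K, x, (fun=> hpow n.+1); split; last first.
      by rewrite -hpowS.
    split => // k /Kx[[Gx _] _]; split => //; rewrite hpow_gt0/=.
    rewrite ler_pdivlMr// mulrC -hpowS; apply: le_trans (ltW n0e).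
    by rewrite ler_hpow leq_addr.
  exists (\bigcup_n U n).
    split; first by apply: bigcupT_measurable => n; have [] := UP n.
    move=> x [Gx Ex]; have := Ethin n0 x Ex.
    move=> /existsNP[n /not_implyP[n0n /negP]]; rewrite -ltNge => H.
    exists (n - n0)%N => //; have [_ + _] := UP (n - n0)%N; apply.
    by rewrite subnKC.
  apply: (@le_trans _ _ (\sum_(0 <= n <oo) mu (U n))%E).
    apply: measure_sigma_subadditive => //; first by move=> n; have [] := UP n.
    by apply: bigcupT_measurable => n; have [] := UP n.
  apply: (@le_trans _ _ (\sum_(0 <= n <oo) (fine s / (2 ^ n.+1)%:R)%:E)%E).
    apply: lee_nneseries => // n _; have [_ _ H] := UP n; apply: le_trans H _.
    rewrite -(fineK sfin) -EFinM lee_fin mulrC ler_wpM2l ?fine_ge0//.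
    rewrite natrX -exprVn -/(hpow n.+1) ler_hpow; lia.
  by apply: le_trans (epsilon_trick0 _ (fine_ge0 s0)) _; rewrite fineK.
have /choice[U UP] : forall k, exists U : set (borel X),
    [/\ measurable U, F k `&` E `<=` U & (mu U <= packing_premeasure d alpha (F k))%E].
  move=> k; have /choice[V VP] : forall i, exists V : set (borel X),
      [/\ measurable V, F k `&` E `<=` V &
        (mu V <= packing_premeasure_delta d alpha (hpow i) (F k))%E].
    by move=> i; have [V [mV FV] muV] := cover (F k) _ (hpow_gt0 R i); exists V.
  have mV : measurable (\bigcap_i V i).
    by apply: bigcapT_measurable => i; have [] := VP i.
  exists (\bigcap_i V i); split => //.
    by move=> x FEx i _; have [_ + _] := VP i; apply.
  rewrite packing_premeasureE; apply: le_ereal_inf_tmp => _ [e /= e0 <-].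
  have [i _ ie] := ex_hpow_lt 0 e0; have [mVi _ muVi] := VP i.
  apply: (@le_trans _ _ (mu (V i))).
    by apply: le_measure; rewrite ?inE// => x; exact.
  by apply: le_trans muVi _; apply: packing_premeasure_delta_le; exact: ltW.
apply: (@le_trans _ _ (\sum_(0 <= k <oo) mu (U k))%E).
  apply: measure_sigma_subadditive => //; first by move=> k; have [] := UP k.
  by move=> x Ex; have [k _ Fkx] := EF _ Ex; exists k => //; have [_ + _] := UP k; apply.
by apply: lee_nneseries => // k _; have [] := UP k.
Qed.

(** A thick set of positive mass bounds the lower dimension by a + 1. If thick
sets are null, a set of positive mass keeps its mass after their removal and
then has positive packing measure for all exponents. *)
Lemma has_packing_dim_pinftyP mu :
  has_packing_dim d mu +oo%E <-> forall a m, mu (thick d mu a m) = 0%E.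
Proof.
have mthick a m : measurable (thick d mu a m : set (borel X)).
  by apply: (@borel_closed X); exact: closed_thick.
split => [[lowoo _] a m|H].
  apply: contrapT => /eqP mu0.
  have : (lower_packing_dim d mu <= a.+1%:R%:E)%E.
    apply: le_trans (packing_dim_thick mu a m); apply: ereal_inf_lbound.
    by exists (thick d mu a m) => //; split => //; rewrite lt0e mu0/=.
  by rewrite lowoo leye_eq.
have dimoo E : measurable (E : set (borel X)) -> (0 < mu E)%E -> packing_dim d E = +oo%E.
  move=> mE muE; apply/eqP; rewrite -leye_eq; apply: le_ereal_inf_tmp.
  move=> _ [alpha [al0 PE] <-]; exfalso.
  pose a := Num.bound alpha; have ala : alpha <= a%:R.
    by apply: ltW; apply: archi_boundP; exact: ltW.
  pose N : set (borel X) := \bigcup_m thick d mu a.+1 m.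
  have mN : measurable N by exact: bigcupT_measurable.
  have muN : mu N = 0%E.
    apply/eqP; rewrite eq_le measure_ge0 andbT.
    apply: (@le_trans _ _ (\sum_(0 <= k <oo) mu (thick d mu a.+1 k))%E).
      exact: measure_sigma_subadditive.
    by rewrite eseries0.
  have mEN : measurable (E `\` N : set (borel X)) by exact: measurableD.
  have thin m x : (E `\` N) x -> ~ thick d mu a.+1 m x.
    by move=> [_ nNx] xt; apply: nNx; exists m.
  have := packing_measure_thin al0 ala mEN thin.
  have : (packing_measure d alpha (E `\` N) <= packing_measure d alpha E)%E.
    apply: ereal_inf_le_tmp => _ [F EF <-]; exists F => //.
    by apply: subset_trans EF; exact: subDsetl.
  rewrite PE => /[swap] /le_trans /[apply].
  have muEN : mu (E `&` N) = 0%E.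
    apply/eqP; rewrite eq_le measure_ge0 andbT -muN.
    by apply: le_measure; rewrite ?inE//; exact: measurableI.
  have muE1 : (mu E < +oo)%E by rewrite (le_lt_trans (probability_le1 mu mE))// ltry.
  have -> : mu (E `\` N) = mu E.
    exact: etrans (measureD mE mN muE1)
      (etrans (congr1 (fun t => mu E - t)%E muEN) (sube0 _)).
  by rewrite leNgt muE.
split; apply/eqP; rewrite -leye_eq; apply: le_ereal_inf_tmp => _ [E [mE muE] <-].
  by rewrite dimoo.
rewrite dimoo//.
have := probability_setC mu (measurableC mE); rewrite setCK => ->.
by rewrite muE sube0.
Qed.

End packing_dimension_thick.

(** * Recurrence rates at dyadic radii *)

Section recurrence_rates.
Context (R : realType) (X : Type) (d : X -> X -> R) (T : X -> X).

(** From the scale m on, waiting times are bounded by the power a of the inverse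
radius 2^n; the upper indicator is infinite when this fails for all a and m
([upper_waiting_pinftyP]). *)
Definition hits (a m : nat) (x y : X) := forall n, (m <= n)%N ->
  exists2 k, (0 < k <= 2 ^ (n * a))%N & mclosed_ball d y (hpow n) (iter k T x).

Lemma ln_hpow n : - ln (hpow n : R) = n%:R * ln 2.
Proof. by rewrite /hpow lnXn ?invr_gt0// lnV ?posrE// mulNrn opprK mulr_natl. Qed.

Lemma ln2_pos : 0 < ln (2 : R).
Proof. by rewrite ln_gt0// ltr1n. Qed.

Lemma ln_pow2 n : ln ((2 ^ n)%:R : R) = n%:R * ln 2.
Proof. by rewrite natrX lnXn// mulr_natl. Qed.

Lemma waiting_time_le x y r (k : nat) : (0 < k)%N ->
  mclosed_ball d y r (iter k T x) -> (waiting_time d T r x y <= k%:R%:E)%E.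
Proof. by move=> k0 yk; apply: ereal_inf_lbound; exists k. Qed.

Lemma waiting_time_ge x y r (c : \bar R) :
  (forall k, (0 < k)%N -> mclosed_ball d y r (iter k T x) -> c <= k%:R%:E)%E ->
  (c <= waiting_time d T r x y)%E.
Proof. by move=> H; apply: le_ereal_inf_tmp => _ [k [k0 yk] <-]; exact: H. Qed.

Lemma waiting_time_ge1 x y r : (1 <= waiting_time d T r x y)%E.
Proof. by apply: waiting_time_ge => k k0 _; rewrite lee_fin ler1n. Qed.

Lemma upper_waiting_pinfty x y : (forall a m, ~ hits a m x y) ->
  upper_waiting_time_indicator d T x y = +oo%E.
Proof.
move=> H; apply/eqP; rewrite -leye_eq; apply: le_ereal_inf_tmp => _ [A A0 <-].
rewrite leye_eq; apply/eqP/eqyP => b b0; pose a := Num.bound b.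
apply: (@le_trans _ _ (a%:R%:E)).
  by rewrite lee_fin; apply: ltW; apply: archi_boundP; exact: ltW.
have [e /= e0 eA] : \forall r \near 0^'+, A r by [].
have [m m0 me] := ex_hpow_lt 1 e0.
have /existsNP[n /not_implyP[mn nH]] := H a m.
have An : A (hpow n).
  apply: eA => /=; last exact: hpow_gt0.
  rewrite sub0r normrN gtr0_norm ?hpow_gt0//.
  by apply: le_lt_trans me; rewrite ler_hpow.
apply: le_trans (ereal_sup_ubound _); last by exists (hpow n); [exact: An|].
have tge : ((2 ^ (n * a))%:R%:E <= waiting_time d T (hpow n) x y)%E.
  apply: waiting_time_ge => k k0 yk; rewrite lee_fin ler_nat leqNgt; apply/negP => kn.
  by apply: nH; exists k => //; rewrite k0 ltnW.
have n0 : (0 < n)%N by exact: leq_trans m0 mn.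
have lnn : 0 < n%:R * ln (2 : R) by rewrite mulr_gt0 ?ln2_pos// ltr0n.
rewrite ln_hpow inver gt_eqF// lee_pdivlMr//.
apply: (@le_trans _ _ (lne ((2 ^ (n * a))%:R%:E : \bar R))).
  rewrite lne_EFin ?ltr0n ?expn_gt0// ln_pow2 -EFinM lee_fin natrM.
  by rewrite mulrA [_ * n%:R]mulrC.
by rewrite lee_lne ?in_itv/= ?leey ?lee_fin ?andbT ?(le_trans _ tge) ?lee_fin.
Qed.

Lemma hits_upper_waiting a m x y : hits a m x y ->
  (upper_waiting_time_indicator d T x y <= (2 * a)%:R%:E)%E.
Proof.
move=> H.
apply: (@le_trans _ _ (ereal_sup ((fun r : R => lne (waiting_time d T r x y) / (- ln r)%:E)%E @`
    [set r | 0 < r < hpow m.+1]))).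
  apply: ereal_inf_lbound; exists [set r | 0 < r < hpow m.+1] => //.
  exists (hpow m.+1) => //=; first exact: hpow_gt0.
  move=> r /=; rewrite sub0r normrN => + r0; rewrite gtr0_norm// => rm.
  by rewrite r0.
apply: ge_ereal_sup => _ [r /= /andP[r0 rm] <-].
have [n mn /andP[nr rn]] := hpow_bracket r0 (ltW rm).
have n0 : (0 < n)%N by exact: leq_trans mn.
have lnn : 0 < n%:R * ln (2 : R) by rewrite mulr_gt0 ?ln2_pos// ltr0n.
have lnr : n%:R * ln 2 <= - ln r.
  by rewrite -ln_hpow lerN2 ler_ln ?posrE// hpow_gt0.
have [|k /andP[k0 kn] yk] := H n.+1; first by lia.
have wt : (waiting_time d T r x y <= (2 ^ (n.+1 * a))%:R%:E)%E.
  apply: (@le_trans _ _ k%:R%:E); last by rewrite lee_fin ler_nat.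
  apply: waiting_time_le => //; apply: le_trans yk _; exact: ltW.
have lnr0 : 0 < - ln r by exact: lt_le_trans lnr.
rewrite inver gt_eqF// lee_pdivrMr//.
apply: (@le_trans _ _ (lne ((2 ^ (n.+1 * a))%:R%:E : \bar R))).
  rewrite lee_lne ?in_itv/= ?leey ?andbT ?lee_fin//.
  by apply: le_trans (waiting_time_ge1 x y r).
rewrite lne_EFin ?ltr0n ?expn_gt0// ln_pow2 -EFinM lee_fin.
apply: le_trans (ler_wpM2l _ lnr) => //.
rewrite mulrA -natrM ler_wpM2r ?(ltW ln2_pos)// ler_nat; nia.
Qed.

Lemma upper_waiting_pinftyP x y : upper_waiting_time_indicator d T x y = +oo%E <->
  forall a m, ~ hits a m x y.
Proof.
split; last exact: upper_waiting_pinfty.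
by move=> oo a m /hits_upper_waiting; rewrite oo leye_eq.
Qed.

End recurrence_rates.

(** * Residual sets of invariant measures *)

Lemma Gdelta_countable_bigcap (X : topologicalType) (I : countType)
    (O : I -> set X) : (forall i, open (O i)) -> Gdelta (\bigcap_i O i).
Proof.
move=> oO; exists (fun n => if unpickle n is Some i then O i else setT).
  by move=> n; case: unpickle => [i|] //; exact: openT.
apply/seteqP; split => x H.
  by move=> n _; case: unpickle => // i; exact: H.
by move=> i _; have := H (pickle i) Logic.I; rewrite pickleK.
Qed.

Lemma Gdelta_dense_of (X : topologicalType) (S : set X) :
  Gdelta S -> dense S -> Gdelta_dense S.
Proof.
move=> [F oF ->] dF; exists F => // i; split => // U U0 oU.
by have [x [Ux Fx]] := dF U U0 oU; exists x; split => //; exact: Fx.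
Qed.

Lemma eq0_hpow (R : realType) d (T : measurableType d) (mu : probability T R) A :
  measurable A -> (forall k, (mu A < (hpow k)%:E)%E) <-> mu A = 0%E.
Proof.
move=> mA; split => [H|-> k]; last by rewrite lte_fin hpow_gt0.
apply/eqP; rewrite eq_le measure_ge0 andbT; apply/lee_addgt0Pr => e e0.
have [k _ ke] := ex_hpow_lt 0 e0; rewrite add0e.
by apply: ltW; apply: lt_trans (H k) _; rewrite lte_fin.
Qed.

Lemma ae_negligibleC d (T : measurableType d) (R : realType)
    (mu : {measure set T -> \bar R}) (P : T -> Prop) :
  {ae mu, forall x, P x} <-> mu.-negligible (~` [set x | P x]).
Proof. by []. Qed.

Section recurrence_sets.
Context (R : realType) (X : ptopologicalType) (d : X -> X -> R) (T : X -> X).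
Hypothesis dc : compatible_metric d.
Hypothesis cT : continuous T.
Local Notation MT := (invariant_probability R T).

Lemma continuous_iter k : continuous (iter k T).
Proof.
elim: k => [|k IH] x; first exact: cvg_id.
by apply: (@continuous_comp _ _ _ (iter k T) T); [exact: IH|exact: cT].
Qed.

Definition recur_set a m : set X := [set x | hits d T a m x x].

Lemma closed_recur_set a m : closed (recur_set a m).
Proof.
have -> : recur_set a m = \bigcap_(n in [set n | (m <= n)%N])
    \bigcup_(k in [set k | (0 < k <= 2 ^ (n * a))%N])
      [set x | d x (iter k T x) <= hpow n].
  by apply/seteqP; split => x H n /H [k kn xk]; exists k.
apply: closed_bigI => n _; apply: closed_bigcup.
  by apply: (sub_finite_set _ (finite_II (2 ^ (n * a)).+1)) => k /= /andP[].
move=> k _; apply: (closed_cmetricP dc) => x H /=.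
apply/ler_addgt0Pr => e e0.
have /(compatible_metric_nbhs dc)[e' e'0 He'] : nbhs x ((iter k T) @^-1` [set y | d (iter k T x) y < e / 2]).
  apply: continuous_iter; apply: (nbhs_cmetric_ball dc); exact: divr_gt0.
have m0 : 0 < Num.min e' (e / 2) by rewrite lt_min e'0 divr_gt0.
have [y /= yk] := H _ m0; rewrite lt_min => /andP[/He' /= H1 H2].
have := cmetric_triangle dc y x (iter k T x).
have := cmetric_triangle dc (iter k T y) y (iter k T x).
rewrite (cmetric_sym dc (iter k T y)); lra.
Qed.

Lemma ae_recurrence_pinftyP (mu : probability (borel X) R) :
  {ae mu, forall x : borel X, upper_recurrence_rate d T x = +oo%E} <->
  forall a m, mu (recur_set a m) = 0%E.
Proof.
have mr a m : measurable (recur_set a m : set (borel X)).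
  by apply: (@borel_closed X); exact: closed_recur_set.
have E : ~` [set x | upper_recurrence_rate d T x = +oo%E] =
    \bigcup_a \bigcup_m recur_set a m.
  apply/seteqP; split => x /=.
    move=> H; apply: contrapT => H'; apply: H; apply/upper_waiting_pinftyP => a m ham.
    by apply: H'; exists a => //; exists m.
  by move=> [a _ [m _ H]] /upper_waiting_pinftyP /(_ a m).
split.
  move/ae_negligibleC; rewrite E => H a m; apply: measure_negligible => //.
  by apply: negligibleS H => x xam; exists a => //; exists m.
move=> H; apply/ae_negligibleC; rewrite E; apply: negligible_bigcup => a.
by apply: negligible_bigcup => m; exists (recur_set a m); split; [exact: mr|exact: H|].
Qed.

Lemma Gdelta_recurrence_pinfty : Gdelta [set mu : MT |
  {ae prob_of mu, forall x : borel X, upper_recurrence_rate d T x = +oo%E}].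
Proof.
rewrite (_ : [set _ | _] = \bigcap_(i : nat * nat * nat)
    [set mu : MT | (prob_of mu (recur_set i.1.1 i.1.2) < (hpow i.2)%:E)%E]).
  apply: Gdelta_countable_bigcap => i; apply: (@portmanteau_closed R X d T dc).
  exact: closed_recur_set.
have mr a m : measurable (recur_set a m : set (borel X)).
  by apply: (@borel_closed X); exact: closed_recur_set.
apply/seteqP; split => mu /=.
  move=> /ae_recurrence_pinftyP H [[a m] k] _ /=.
  by rewrite H lte_fin hpow_gt0.
move=> H; apply/ae_recurrence_pinftyP => a m.
by apply/(eq0_hpow _ (mr a m)) => k; exact: (H (a, m, k)).
Qed.

Variable C : nat -> set X.
Hypothesis Cb : countable_base C.

Lemma Gdelta_packing_pinfty :
  Gdelta [set mu : MT | has_packing_dim d (prob_of mu) +oo%E].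
Proof.
rewrite (_ : [set _ | _] = \bigcap_(i : nat * nat * nat)
    [set mu : MT | (prob_of mu (thick d (prob_of mu) i.1.1 i.1.2) < (hpow i.2)%:E)%E]).
  by apply: Gdelta_countable_bigcap => i; exact: (open_thick_lt dc Cb).
have mt (mu : probability (borel X) R) a m : measurable (thick d mu a m : set (borel X)).
  by apply: (@borel_closed X); exact: closed_thick.
apply/seteqP; split => mu /=.
  move=> /(has_packing_dim_pinftyP dc Cb) H [[a m] k] _ /=.
  by rewrite H lte_fin hpow_gt0.
move=> H; apply/(has_packing_dim_pinftyP dc Cb) => a m.
by apply/(eq0_hpow _ (mt _ a m)) => k; exact: (H (a, m, k)).
Qed.

(** With a countable base, open subsets of the product are countable unions of
rectangles, hence measurable for the product of the Borel sigma-algebras. *)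
Lemma open_prod_measurable (O : set (X * X)) :
  (forall x y, O (x, y) -> exists U V, [/\ nbhs x U, nbhs y V & U `*` V `<=` O]) ->
  measurable (O : set (borel X * borel X)).
Proof.
move=> H; pose D (ij : nat * nat) : set (borel X * borel X) :=
  if pselect (C ij.1 `*` C ij.2 `<=` O) then C ij.1 `*` C ij.2 else set0.
have mC k : measurable (C k : set (borel X)) by apply: (@borel_open X); exact: Cb.1.
have mD ij : measurable (D ij).
  by rewrite /D; case: pselect => ? //=; exact: measurableX.
have -> : O = \bigcup_ij D ij.
  apply/seteqP; split => [[x y] Oxy|xy [ij _]].
    have [U [V [xU yV UV]]] := H _ _ Oxy.
    have [i Cix CiU] := Cb.2 _ _ xU; have [j Cjy CjV] := Cb.2 _ _ yV.
    exists (i, j) => //; rewrite /D /=; case: pselect => //= nCO.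
    by exfalso; apply: nCO => -[x' y'] [/= Cx' Cy']; apply: UV; split; [exact: CiU|exact: CjV].
  by rewrite /D; case: pselect => //= CO; exact: CO.
by apply: countable_bigcupT_measurable => //; exact: countableP.
Qed.

Lemma measurable_hits a m :
  measurable ([set xy | hits d T a m xy.1 xy.2] : set (borel X * borel X)).
Proof.
rewrite [X in measurable X](_ : _ = \bigcap_(n in [set n | (m <= n)%N])
    \bigcup_(k in [set k | (0 < k <= 2 ^ (n * a))%N])
      [set xy : borel X * borel X | d xy.2 (iter k T xy.1) <= hpow n]); last first.
  by apply/seteqP; split => xy H n /H [k kn xk]; exists k.
apply: bigcap_measurable => [|n _]; first by exists m => /=.
apply: bigcup_measurable => k _.
rewrite -[X in measurable X]setCK; apply: measurableC.
apply: open_prod_measurable => x y /= /negP; rewrite -ltNge => lt.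
pose e := (d y (iter k T x) - hpow n) / 2.
have e0 : 0 < e by rewrite divr_gt0// subr_gt0.
exists ((iter k T) @^-1` [set z | d (iter k T x) z < e]), [set z | d y z < e]; split.
- by apply: continuous_iter; exact: (nbhs_cmetric_ball dc).
- exact: (nbhs_cmetric_ball dc).
move=> [x' y'] [/= H1 H2]; apply/negP; rewrite -ltNge.
have := cmetric_triangle dc y' y (iter k T x).
have := cmetric_triangle dc (iter k T x') y' (iter k T x).
rewrite (cmetric_sym dc (iter k T x') (iter k T x)); rewrite /e in H1 H2; lra.
Qed.

Lemma invariant_iter (mu : MT) k (A : set (borel X)) : measurable A ->
  prob_of mu (iter k T @^-1` A) = prob_of mu A.
Proof.
elim: k A => // k IH A mA.
have mTA : measurable (T @^-1` A : set (borel X)).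
  have := continuous_borel_measurable cT; move=> /(_ measurableT A mA).
  by rewrite setTI.
transitivity (prob_of mu (T @^-1` A)).
  rewrite -(IH (T @^-1` A))//; congr (prob_of mu _).
exact: (set_mem (valP (mu : @invariant_measures R X T)) A mA).
Qed.

(** For fixed y that is not thick, some ball B(y, 2^-n) has mass below
2^-(n (a + 1)). By invariance its preimages under the first 2^(n a) iterates
have total mass below 2^-n, and Fubini concludes. *)
Lemma packing_pinfty_waiting (mu : MT) : has_packing_dim d (prob_of mu) +oo%E ->
  {ae (prob_of mu \x prob_of mu)%E, forall xy : borel X * borel X,
      upper_waiting_time_indicator d T xy.1 xy.2 = +oo%E}.
Proof.
move=> /(has_packing_dim_pinftyP dc Cb) Hthick.
have mt a m : measurable (thick d (prob_of mu) a m : set (borel X)).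
  by apply: (@borel_closed X); exact: closed_thick.
pose H a m : set (borel X * borel X) := [set xy | hits d T a m xy.1 xy.2].
have mH a m : measurable (H a m) by exact: measurable_hits.
suff H0 a m : (prob_of mu \x prob_of mu)%E (H a m) = 0%E.
  apply/ae_negligibleC.
  have -> : ~` [set xy : borel X * borel X | upper_waiting_time_indicator d T xy.1 xy.2 = +oo%E] =
      \bigcup_a \bigcup_m H a m.
    apply/seteqP; split => x /=.
      move=> K; apply: contrapT => K'; apply: K; apply/upper_waiting_pinftyP => a m ham.
      by apply: K'; exists a => //; exists m.
    by move=> [a _ [m _ K]] /upper_waiting_pinftyP /(_ a m).
  apply: negligible_bigcup => a; apply: negligible_bigcup => m.
  by exists (H a m); split; [exact: mH|exact: H0|].
have -> : (prob_of mu \x prob_of mu)%E (H a m) = (prob_of mu \x^ prob_of mu)%E (H a m).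
  apply: product_measure_unique => //= ? ? ? ?; rewrite product_measure2E//.
rewrite /product_measure2.
transitivity (\int[prob_of mu]_x (cst 0%E x : \bar R))%E; last by rewrite integral0.
apply: ge0_ae_eq_integral => //.
  exact: measurable_fun_ysection.
pose N : set (borel X) := \bigcup_m' thick d (prob_of mu) a.+1 m'.
exists N; split; first exact: bigcupT_measurable.
  apply/eqP; rewrite eq_le measure_ge0 andbT.
  apply: (@le_trans _ _ (\sum_(0 <= k <oo) prob_of mu (thick d (prob_of mu) a.+1 k))%E).
    apply: measure_sigma_subadditive => //; exact: bigcupT_measurable.
  by rewrite eseries0// => k _ _; exact: Hthick.
move=> y; apply: contra_notP => nNy _ /=.
apply/eqP; rewrite eq_le measure_ge0 andbT; apply/lee_addgt0Pr => e e0; rewrite add0e.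
have [m' mm' m'e] := ex_hpow_lt m e0.
have : ~ thick d (prob_of mu) a.+1 m' y by move=> yt; apply: nNy; exists m'.
move=> /existsNP[n /not_implyP[m'n /negP]]; rewrite -ltNge => small.
pose B : set (borel X) := mclosed_ball d y (hpow n).
have mB : measurable B by exact: measurable_mclosed_ball.
have mTB k : measurable (iter k T @^-1` B : set (borel X)).
  have := continuous_borel_measurable (continuous_iter (k:=k)) measurableT mB.
  by rewrite setTI.
apply: (@le_trans _ _ (prob_of mu (\big[setU/set0]_(0 <= k < (2 ^ (n * a))) (iter k.+1 T @^-1` B))%E)).
  apply: le_measure; rewrite ?inE.
  - exact: measurable_ysection.
  - exact: bigsetU_measurable.
  move=> x; rewrite /ysection/= inE => /(_ n (leq_trans mm' m'n)) /=.
  move=> [[//|k] /andP[_ kn] xB]; rewrite big_mkord.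
  rewrite -(bigcup_mkord _ (fun k => iter k.+1 T @^-1` B)).
  by exists k.
apply: (@le_trans _ _ (\sum_(0 <= k < 2 ^ (n * a)) prob_of mu (iter k.+1 T @^-1` B))%E).
  elim: (2 ^ (n * a))%N => [|K IH]; first by rewrite !big_geq// measure0.
  rewrite !big_nat_recr//=; apply: le_trans (leeD2r _ IH).
  by apply: measureU2 => //; exact: bigsetU_measurable.
apply: (@le_trans _ _ (\sum_(0 <= k < 2 ^ (n * a)) (hpow (n * a.+1))%:E)%E).
  by apply: lee_sum => k _; rewrite invariant_iter// ltW.
rewrite sumEFin sumr_const_nat subn0 lee_fin -mulr_natl.
rewrite mulnS addnC hpowD mulrA natrX.
have -> : (2 ^+ (n * a) * hpow (n * a) : R) = 1.
  by rewrite /hpow -exprMn divff// expr1n.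
by rewrite mul1r; apply: le_trans (ltW m'e); rewrite ler_hpow.
Qed.

End recurrence_sets.

(** * The product topology on bilateral sequences *)

Lemma lipschitz_continuous (R : realType) (X : topologicalType)
    (d : X -> X -> R) (f : X -> X) :
  compatible_metric d -> metric_lipschitz d f -> continuous f.
Proof.
move=> dc [L HL] x A /= /(compatible_metric_nbhs dc)[e e0 eA].
have L0 : 0 < `|L| + 1 by rewrite ltr_pwDr.
apply: filterS (nbhs_cmetric_ball dc x (divr_gt0 e0 L0)) => y /= xy; apply: eA => /=.
apply: le_lt_trans (HL x y) _.
move: xy; rewrite ltr_pdivlMr// mulrC; apply: le_lt_trans.
apply: ler_wpM2r; first exact: (cmetric_ge0 dc).
by apply: le_trans (ler_norm _) _; rewrite lerDl.
Qed.

Section bilateral_topology.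
Context (R : realType) (M : completeMetricType R).
Local Notation X := (bilateral_product M).

Lemma bilateral_proj_continuous (i : int) : continuous (fun x : X => x i).
Proof. exact: (@proj_continuous int (fun=> M) i). Qed.

Lemma bilateral_cvg (u : nat -> X) (x : X) :
  (forall i, u n i @[n --> \oo] --> x i) -> u @ \oo --> x.
Proof.
move=> H; suff : (u : nat -> {ptws int -> M}) @ \oo --> (x : {ptws int -> M}) by [].
apply/cvg_sup => i; apply/cvg_image.
  by rewrite predeqE => r; split => // _; exists (fun=> r).
move=> A /(H i)[N _ HN]; exists [set z : X | A (z i)]; first by exists N.
by apply/seteqP; split => [r [h hA <-]//|r Ar]; exists (fun=> r).
Qed.

(** Otherwise points ever closer to x on ever larger windows would avoid A and
yet converge to x. *)
Lemma bilateral_nbhs (x : X) (A : set X) : nbhs x A ->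
  exists a : nat, forall z : X,
    (forall i : int, (`|i| <= a)%N -> ball (x i) (hpow a) (z i)) -> A z.
Proof.
move=> xA; apply: contrapT => /forallNP H.
have /choice[u uP] : forall a, exists z : X,
    (forall i : int, (`|i| <= a)%N -> ball (x i) (hpow a) (z i)) /\ ~ A z.
  by move=> a; have /existsNP[z /not_implyP[z1 z2]] := H a; exists z.
have ux : u @ \oo --> x.
  apply: bilateral_cvg => i; apply/cvg_ballP => e e0.
  have [n _ ne] := ex_hpow_lt 0 e0.
  exists (maxn `|i| n) => // k /=; rewrite geq_max => /andP[ik nk].
  apply: (@le_ball _ _ _ (hpow k)); last exact: (uP k).1.
  by apply: le_trans (ltW ne); rewrite ler_hpow.
by have [N _ /(_ N (leqnn N))] := ux _ xA; exact: (uP N).2.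
Qed.

Definition in_box (O : nat -> set M) (s : seq (int * nat)) : set X :=
  [set z | forall i n, (i, n) \in s -> O n (z i)].

Lemma in_box_nil O : in_box O [::] = setT.
Proof. by apply/seteqP; split => // z _ i n; rewrite in_nil. Qed.

Lemma in_box_cons O i n s :
  in_box O ((i, n) :: s) = [set z | O n (z i)] `&` in_box O s.
Proof.
apply/seteqP; split => z.
  move=> H; split; first by apply: H; rewrite mem_head.
  by move=> j k jk; apply: H; rewrite in_cons jk orbT.
by move=> [H1 H2] j k; rewrite in_cons => /predU1P[[-> ->]//|]; exact: H2.
Qed.

Lemma in_box_cat O s t : in_box O (s ++ t) = in_box O s `&` in_box O t.
Proof.
elim: s => [|[i n] s IH]; first by rewrite in_box_nil setTI.
by rewrite cat_cons !in_box_cons IH setIA.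
Qed.

Lemma open_in_box O s : (forall n, open (O n)) -> open (in_box O s).
Proof.
move=> oO; elim: s => [|[i n] s IH]; first by rewrite in_box_nil; exact: openT.
rewrite in_box_cons; apply: openI => //.
by have /continuousP := @bilateral_proj_continuous i; apply.
Qed.

Lemma metric_countable_base : separable M -> exists O : nat -> set M, countable_base O.
Proof.
move=> [D /countable_injP[f finj] dD].
pose q n := xget (point : M) [set x | D x /\ f x = n].
have qf x : D x -> q (f x) = x.
  move=> Dx; have [] : D (q (f x)) /\ f (q (f x)) = f x.
    exact: (@xgetPex _ point [set y | D y /\ f y = f x] (ex_intro _ x (conj Dx erefl))).
  by move=> Dq; apply: finj; rewrite inE.
exists (fun n => if (unpickle n : option (nat * nat)%type) is Some kj
  then interior (ball (q kj.1) (hpow kj.2 : R)) else set0); split.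
  by move=> n; case: unpickle => [kj|]; [exact: open_interior|exact: open0].
move=> x A /nbhs_ballP[e /= e0 eA].
have [j _ je] := ex_hpow_lt 0 e0.
have [y [yx Dy]] : interior (ball x (hpow j.+2 : R)) `&` D !=set0.
  apply: dD; last exact: open_interior.
  by exists x; apply: nbhsx_ballx; exact: hpow_gt0.
have {}yx := interior_subset yx.
exists (pickle (f y, j.+1)); rewrite pickleK /= qf//.
  rewrite /interior; apply/nbhs_ballP; exists (hpow j.+2) => /=; first exact: hpow_gt0.
  move=> z xz; rewrite hpowS mulr_natl mulr2n.
  by apply: ball_triangle xz; exact: ball_sym.
move=> z /interior_subset yz; apply: eA; apply: le_ball (ltW je) _ _.
rewrite (hpowS _ j) mulr_natl mulr2n; apply: ball_triangle yz.
by apply: le_ball yx; rewrite ler_hpow.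
Qed.

Definition box_base (O : nat -> set M) (k : nat) : set X :=
  if unpickle k is Some s then in_box O s else set0.

Lemma box_base_countable_base O : countable_base O -> countable_base (box_base O).
Proof.
move=> [oO bO]; split.
  by move=> k; rewrite /box_base; case: unpickle => [s|]; [exact: open_in_box|exact: open0].
move=> x A /bilateral_nbhs[a aA].
have /choice[ka kaP] : forall i : int, exists k, O k (x i) /\ O k `<=` ball (x i) (hpow a).
  by move=> i; have [k] := bO _ _ (nbhsx_ballx (x i) _ (hpow_gt0 R a)); exists k.
pose s := [seq (i, ka i) | i <- [seq (Posz j - Posz a)%R | j <- iota 0 (a + a).+1]].
exists (pickle s); rewrite /box_base pickleK.
  by move=> i n /mapP[j _ [-> ->]]; exact: (kaP j).1.
move=> z zs; apply: aA => i ia; apply: (kaP i).2; apply: zs.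
apply: map_f; apply/mapP; exists (absz (i + Posz a)%R); rewrite ?mem_iota; lia.
Qed.

Lemma coord_measurable O d (T : measurableType d) (f : T -> X) : countable_base O ->
  (forall i n, measurable [set t | O n (f t i)]) ->
  measurable_fun setT (f : T -> borel X).
Proof.
move=> bO mf; have [oB bB] := box_base_countable_base bO.
apply: (@borel_measurable_fun X) => U oU.
have ms s : measurable (f @^-1` in_box O s).
  elim: s => [|[i n] s IH].
    by rewrite in_box_nil preimage_setT; exact: measurableT.
  by rewrite in_box_cons preimage_setI; apply: measurableI => //; exact: mf.
rewrite (_ : f @^-1` U = \bigcup_(k in [set k | box_base O k `<=` U]) (f @^-1` box_base O k)).
  apply: bigcup_measurable => k _; rewrite /box_base; case: unpickle => [s|].
    exact: ms.
  by rewrite preimage_set0; exact: measurable0.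
apply/seteqP; split => t /=; last by move=> [k kU] /kU.
move=> Uft; have [k ft kU] := bB (f t) U (open_nbhs_nbhs (conj oU Uft)).
by exists k.
Qed.

(** The boxes are stable under intersection and, by the countable base, generate
the Borel sets. *)
Lemma box_measure_unique O (P Q : probability (borel X) R) : countable_base O ->
  (forall s, P (in_box O s) = Q (in_box O s)) ->
  forall A : set (borel X), measurable A -> P A = Q A.
Proof.
move=> bO PQ A mA; have [oB bB] := box_base_countable_base bO.
pose G : set (set (borel X)) := [set in_box O s | s in setT].
apply: (@measure_unique _ R (borel X) G (fun=> setT)) => //.
- apply/seteqP; split; last first.
    apply: smallest_sub; first exact: sigma_algebra_measurable.
    by move=> _ [s _ <-]; apply: (@borel_open X); apply: open_in_box; exact: bO.1.
  apply: smallest_sub; first exact: smallest_sigma_algebra.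
  move=> U oU.
  rewrite (_ : U = \bigcup_(k in [set k | box_base O k `<=` U]) box_base O k); last first.
    apply/seteqP; split => t /=; last by move=> [k kU] /kU.
    move=> Uft; have [k ft kU] := bB t U (open_nbhs_nbhs (conj oU Uft)).
    by exists k.
  apply: (@bigcup_measurable _ (g_sigma_algebraType G)) => k _.
  rewrite /box_base; case: unpickle => [s|]; last exact: measurable0.
  by apply: sub_sigma_algebra; exists s.
- move=> _ _ [s _ <-] [t _ <-]; exists (s ++ t) => //; exact: in_box_cat.
- by move=> _; exists [::] => //; exact: in_box_nil.
- by rewrite bigcup_const.
- by move=> _ [s _ <-]; exact: PQ.
- by move=> _; rewrite (le_lt_trans (probability_le1 P measurableT))// ltry.
Qed.

End bilateral_topology.

(** * Words that spell a 2-adic integer *)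

Delimit Scope int_scope with int.

Section dyadic_integers.

Definition pow2 (b : nat) : int := 2 ^+ b.

Lemma pow2_gt0 b : 0 < pow2 b.
Proof. exact: exprn_gt0. Qed.

Lemma pow2_neq0 b : pow2 b != 0.
Proof. by rewrite gt_eqF ?pow2_gt0. Qed.

Lemma pow2D a b : pow2 (a + b) = pow2 a * pow2 b.
Proof. exact: exprD. Qed.

Lemma dvd_pow2 a b : (a <= b)%N -> (pow2 a %| pow2 b)%int.
Proof. by move=> ab; rewrite -(subnK ab) pow2D dvdz_mull. Qed.

Lemma dvd_pow2_trans a b z : (a <= b)%N -> (pow2 b %| z)%int -> (pow2 a %| z)%int.
Proof. by move=> /dvd_pow2; exact: dvdz_trans. Qed.

Definition digit (k m : nat) (t : int) : int := ((t %/ pow2 (k * m))%int %% pow2 k)%int.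

Lemma digit_ge0 k m t : 0 <= digit k m t.
Proof. by rewrite /digit modz_ge0// pow2_neq0. Qed.

Lemma digit_lt k m t : digit k m t < pow2 k.
Proof. by rewrite /digit ltz_pmod// pow2_gt0. Qed.

Lemma digit_period k m M t q : (m < M)%N ->
  digit k m (t + pow2 (k * M) * q) = digit k m t.
Proof.
move=> mM; rewrite /digit.
have -> : pow2 (k * M) * q = (pow2 k * (pow2 (k * (M - m).-1) * q)) * pow2 (k * m).
  rewrite mulrA -pow2D mulrAC -pow2D; congr (pow2 _ * _).
  by rewrite -mulnS -mulnDr; congr (_ * _)%N; lia.
rewrite addrC divzMDl ?pow2_neq0// addrC.
by rewrite [pow2 k * _]mulrC addrC modzMDl.
Qed.

Lemma digit_inj k M t t' :
  (forall m, (m < M)%N -> digit k m t = digit k m t') ->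
  (pow2 (k * M) %| t - t')%int.
Proof.
elim: M => [|M IH] H; first by rewrite muln0 dvd1z.
have /IH tt' : forall m, (m < M)%N -> digit k m t = digit k m t'.
  by move=> m mM; apply: H; exact: ltnW.
have := H M (leqnn _); rewrite /digit => HM.
have P0 := pow2_neq0 (k * M).
have /eqP mm : (t == t' %[mod pow2 (k * M)])%int by rewrite eqz_mod_dvd.
have E := divz_eq t (pow2 (k * M)); have E' := divz_eq t' (pow2 (k * M)).
rewrite mulnS addnC pow2D [X in (_ %| X - _)%int]E E' mm.
rewrite opprD addrACA subrr addr0 -mulrBl [pow2 (k * M) * _]mulrC dvdz_mul2r//.
by rewrite -eqz_mod_dvd; apply/eqP.
Qed.

(** Positions divisible by 2^v are grouped in blocks of 2^p positions. For
z = 2^(v + p) t + 2^v m with m < 2^p, the letter at z consists of the m-th digit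
of the block number t in base 2^k and of a bit marking the first position of
the block ([symbol_block]). A block therefore spells k * 2^p bits of its own
number. *)
Definition symbol (v p k : nat) (z : int) : nat :=
  (2 * `|digit k `|((z %% pow2 (v + p))%int %/ pow2 v)%int| (z %/ pow2 (v + p))%int|
   + (pow2 (v + p) %| z)%int)%N.

Lemma symbol_lt v p k z : (symbol v p k z < 2 * 2 ^ k)%N.
Proof.
rewrite /symbol; set D := digit _ _ _.
have D0 : 0 <= D by exact: digit_ge0.
have DK : D < pow2 k by exact: digit_lt.
have E : pow2 k = (2 ^ k)%N by rewrite /pow2 -natz natrX.
have : (`|D| < 2 ^ k)%N by rewrite E in DK; lia.
by case: (_ %| z)%int; lia.
Qed.

Lemma subpos_lt v p z : (`|((z %% pow2 (v + p))%int %/ pow2 v)%int| < 2 ^ p)%N.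
Proof.
have h1 : 0 <= (z %% pow2 (v + p))%int by rewrite modz_ge0// pow2_neq0.
have h2 : (z %% pow2 (v + p))%int < pow2 (v + p) by rewrite ltz_pmod// pow2_gt0.
have h3 : ((z %% pow2 (v + p))%int %/ pow2 v)%int < pow2 p.
  by rewrite ltz_divLR ?pow2_gt0// mulrC -pow2D.
have h4 : 0 <= ((z %% pow2 (v + p))%int %/ pow2 v)%int by rewrite divz_ge0 ?pow2_gt0.
have E : pow2 p = (2 ^ p)%N by rewrite /pow2 -natz natrX.
by rewrite E in h3; lia.
Qed.

Lemma symbol_period v p k z q :
  symbol v p k (z + pow2 (v + p + k * 2 ^ p) * q) = symbol v p k z.
Proof.
rewrite /symbol pow2D -mulrA [pow2 (v + p) * _]mulrC.
rewrite [z + _]addrC modzMDl divzMDl ?pow2_neq0//.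
rewrite (rpredDl _ (dvdz_mull _ (dvdzz _))) addrC digit_period//.
exact: subpos_lt.
Qed.

Lemma symbol_block v p k t m : (m < 2 ^ p)%N ->
  symbol v p k (pow2 (v + p) * t + pow2 v * m%:Z) =
  (2 * `|digit k m t| + (m == 0%N))%N.
Proof.
move=> mp; have mlt : pow2 v * m%:Z < pow2 (v + p).
  rewrite pow2D ltr_pM2l ?pow2_gt0//.
  have -> : pow2 p = (2 ^ p)%N by rewrite /pow2 -natz natrX.
  by rewrite ltz_nat.
have m0 : 0 <= pow2 v * m%:Z by rewrite mulr_ge0// ltW ?pow2_gt0.
rewrite /symbol mulrC modzMDl divzMDl ?pow2_neq0//.
have e1 : ((pow2 v * m%:Z) %% pow2 (v + p))%int = pow2 v * m%:Z.
  by rewrite modz_small// m0 mlt.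
have e2 : ((pow2 v * m%:Z) %/ pow2 (v + p))%int = 0.
  by rewrite divz_small// m0 /= gtz0_abs ?pow2_gt0.
rewrite e1 e2 addr0 mulKz ?pow2_neq0//; congr (_ + nat_of_bool _)%N.
rewrite (rpredDl _ (dvdz_mull _ (dvdzz _))).
apply/idP/idP => [/dvdz_mod0P|/eqP ->]; last by rewrite mulr0 dvdz0.
by rewrite e1 => /eqP; rewrite mulf_eq0 (negbTE (pow2_neq0 _)).
Qed.

(** Some block is contained in the positions that are read. The mark of its first
position determines s' modulo 2^(v + p), then its letters determine the block
number modulo 2^(k * 2^p). *)
Lemma symbol_decode v p k (s s' : int) :
  (forall i : nat, (i <= 2 ^ (v + p).+1)%N -> (pow2 v %| s - i%:Z)%int ->
    symbol v p k (s - i%:Z) = symbol v p k (s' - i%:Z)) ->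
  (pow2 (v + p + k * 2 ^ p) %| s - s')%int.
Proof.
move=> H; pose P := pow2 (v + p).
have PE : P = (2 ^ (v + p))%N by rewrite /P /pow2 -natz natrX.
(* s - K is the start of the block before the one that contains s, hence all of
   that block lies between s - K and s. *)
pose K := (`|(s %% P)%int| + 2 ^ (v + p))%N.
have r0 : 0 <= (s %% P)%int by rewrite modz_ge0// pow2_neq0.
have rP : (s %% P)%int < P by rewrite ltz_pmod// pow2_gt0.
have KE : K%:Z = (s %% P)%int + P by rewrite /K PE; lia.
have KP : (K < 2 ^ (v + p).+1)%N by rewrite expnS /K; rewrite PE in rP; lia.
pose t := (s %/ P)%int - 1.
have sK : s - K%:Z = P * t.
  by rewrite KE {1}(divz_eq s P) /t; ring.
have vK m : (m < 2 ^ p)%N -> (2 ^ v * m <= K)%N.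
  move=> mp; apply: (@leq_trans (2 ^ (v + p))); last by rewrite /K leq_addl.
  by rewrite expnD leq_pmul2l ?expn_gt0// ltnW.
have pos x m : (m < 2 ^ p)%N -> x - (K - 2 ^ v * m)%N%:Z = (x - K%:Z) + pow2 v * m%:Z.
  move=> mp; rewrite -subzn ?vK// opprB addrA addrAC PoszM; congr (_ + _ * _).
  by rewrite /pow2 -natz natrX.
have Hm m : (m < 2 ^ p)%N ->
    symbol v p k (P * t + pow2 v * m%:Z) = symbol v p k ((s' - K%:Z) + pow2 v * m%:Z).
  move=> mp; rewrite -sK -!pos//; apply: H.
    by apply: leq_trans (ltnW KP); exact: leq_subr.
  by rewrite pos// sK /P pow2D -mulrA -mulrDr dvdz_mulr.
have p0 : (0 < 2 ^ p)%N by rewrite expn_gt0.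
have [t' sK'] : exists t', s' - K%:Z = P * t'.
  have := Hm 0%N p0; rewrite symbol_block// mulr0 addr0 eqxx /symbol.
  case: (boolP (_ %| s' - K%:Z)%int) => [/dvdzP[t' ->] _|_]; first by exists t'; rewrite mulrC.
  by lia.
have : (pow2 (k * 2 ^ p) %| t - t')%int.
  apply: digit_inj => m mp; have := Hm m mp; rewrite sK' !symbol_block//.
  have := digit_ge0 k m t; have := digit_ge0 k m t'; lia.
move=> /dvdzP[q tq]; apply/dvdzP; exists q.
have -> : s - s' = (s - K%:Z) - (s' - K%:Z) by ring.
by rewrite sK sK' -mulrBr tq pow2D; ring.
Qed.

End dyadic_integers.

(** * Levels of the symbolic process *)

Section symbolic_process.
Variables (lam : nat) (modulus : nat -> nat) (v0 : nat).

Section level_parameters.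
Variables (j : nat) (st : nat * nat).
Let v := st.1.
(** With p = block_bits, the factor 2^v.+1 compensates the exponent
lam * 2^(v + p).+1 lost to the expansion of the shift, since a block has 2^p
letters ([scale_lt_depth]). *)
Definition digit_bits := (lam * 2 ^ v.+1 * j).+1.
Definition next_offset := (st.2 + 2 * 2 ^ digit_bits)%N.
Definition block_bits := (modulus next_offset * j)%N.
Definition phase_bits := (v + block_bits + digit_bits * 2 ^ block_bits)%N.
Definition word_length := (2 ^ (v + block_bits).+1)%N.
Definition radius_exp := (modulus next_offset + lam * word_length)%N.
(** The windows of level j have fewer than 2^(word_length + 2 * modulus + 1)
positions, so that a given one contains a position of the next level with
probability at most 2^-j. *)
Definition next_spacing :=
  (phase_bits + j + word_length + 2 * modulus next_offset + 1)%N.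
End level_parameters.

(** The two components are the exponent of the spacing of level j and the index
of its first letter: level j puts letters with indices from [offset j] up to,
and excluding, [offset j.+1] at positions divisible by 2^(spacing j). *)
Fixpoint level (j : nat) : nat * nat :=
  if j is j'.+1 then (next_spacing j' (level j'), next_offset j' (level j'))
  else (v0, 0%N).

Definition spacing j := (level j).1.
Definition offset j := (level j).2.
Definition depth j := phase_bits j (level j).
Definition reach j := word_length j (level j).
Definition scale j := radius_exp j (level j).

Lemma offsetS j : (offset j < offset j.+1)%N.
Proof.
rewrite /offset /= /next_offset -[X in (X < _)%N]addn0 ltn_add2l muln_gt0 /=.
by rewrite expn_gt0.
Qed.

Lemma offset_homo : {homo offset : i j / (i <= j)%N}.
Proof. by apply: homo_leq => //; [exact: leq_trans|move=> j; exact: ltnW (offsetS j)]. Qed.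

Lemma spacing_le_depth j : (spacing j <= depth j)%N.
Proof. by rewrite /depth /phase_bits -addnA leq_addr. Qed.

Lemma spacingS j : spacing j.+1 = (depth j + j + reach j + 2 * modulus (offset j.+1) + 1)%N.
Proof. by []. Qed.

Lemma depth_le_spacingS j : (depth j <= spacing j.+1)%N.
Proof. by rewrite spacingS; lia. Qed.

Lemma spacing_homo : {homo spacing : i j / (i <= j)%N}.
Proof.
apply: homo_leq => //; first exact: leq_trans.
by move=> j; apply: leq_trans (spacing_le_depth j) (depth_le_spacingS j).
Qed.

Lemma spacing_ge j : (v0 + j <= spacing j)%N.
Proof.
elim: j => [|j IH]; first by rewrite addn0.
by have := spacing_le_depth j; rewrite spacingS; lia.
Qed.

(** The cost of reading a word is [scale j]; the word reveals [depth j] bits of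
the phase, more than j times the cost. *)
Lemma scale_lt_depth j : (scale j * j < depth j)%N.
Proof.
rewrite /scale /depth /radius_exp /phase_bits /word_length /digit_bits.
set e := modulus _; set v := (level j).1.
have -> : block_bits j (level j) = (e * j)%N by [].
set p := (e * j)%N; rewrite mulSn mulnDl.
have h : (p < 2 ^ p)%N by exact: ltn_expl.
have -> : (lam * 2 ^ (v + p).+1 * j = lam * 2 ^ v.+1 * j * 2 ^ p)%N.
  by rewrite -addSn expnD; ring.
rewrite -/p; lia.
Qed.

Lemma scale_ge j : (0 < lam)%N -> (j <= scale j)%N.
Proof.
move=> l0; rewrite /scale /radius_exp /word_length.
apply: (@leq_trans (spacing j)); first by apply: leq_trans (spacing_ge j); exact: leq_addl.
apply: (@leq_trans (2 ^ (spacing j + block_bits j (level j)).+1)).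
  apply: leq_trans (ltnW (ltn_expl _ (ltnSn 1))); lia.
apply: leq_trans (leq_addl _ _); by rewrite leq_pmull.
Qed.

Definition letter j (z : int) : nat :=
  (offset j + symbol (spacing j) (block_bits j (level j)) (digit_bits j (level j)) z)%N.

Lemma letter_range j z : (offset j <= letter j z < offset j.+1)%N.
Proof. by rewrite leq_addr /= /offset /= ltn_add2l symbol_lt. Qed.

Lemma dvdz_sub_eq b z z' : (pow2 b %| z - z')%int -> exists q, z = z' + pow2 b * q.
Proof. by move=> /dvdzP[q zq]; exists q; rewrite mulrC -zq subrKC. Qed.

Lemma letter_period j z z' : (pow2 (depth j) %| z - z')%int -> letter j z = letter j z'.
Proof. by move=> /dvdz_sub_eq[q ->]; rewrite /letter /depth /phase_bits symbol_period. Qed.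

Fixpoint symb (J : nat) (z : int) : option nat :=
  if J is J'.+1 then
    if (pow2 (spacing J') %| z)%int then Some (letter J' z) else symb J' z
  else None.

Lemma dvdz_pow2_congr b z z' : (pow2 b %| z - z')%int -> (pow2 b %| z)%int = (pow2 b %| z')%int.
Proof.
move=> /dvdz_sub_eq[q ->]; rewrite addrC.
by rewrite (rpredDl _ (dvdz_mulr _ (dvdzz _))).
Qed.

Lemma symb_period J z z' : (pow2 (spacing J) %| z - z')%int -> symb J z = symb J z'.
Proof.
elim: J => //= J IH zz'.
rewrite (@dvdz_pow2_congr _ z z'); last first.
  by apply: dvd_pow2_trans zz'; apply: spacing_homo.
rewrite (@letter_period _ z z'); last by apply: dvd_pow2_trans zz'; exact: depth_le_spacingS.
by rewrite IH//; apply: dvd_pow2_trans zz'; apply: spacing_homo.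
Qed.

Lemma symb_Some J z c : symb J z = Some c ->
  exists j, [/\ (j < J)%N, (pow2 (spacing j) %| z)%int & c = letter j z].
Proof.
elim: J => //= J IH; case: ifPn => [zJ [<-]|_ /IH[j [jJ zj cj]]]; first by exists J.
by exists j; split => //; exact: ltnW.
Qed.

Lemma symb_stable J J' z : (J <= J')%N -> ~~ (pow2 (spacing J) %| z)%int ->
  symb J' z = symb J z.
Proof.
move=> JJ' nJ; elim: J' JJ' => [|J' IH]; first by rewrite leqn0 => /eqP ->.
rewrite leq_eqVlt ltnS => /predU1P[->//|JJ'] /=.
rewrite ifN ?IH//; apply: contra nJ; apply: dvd_pow2_trans; exact: spacing_homo.
Qed.

(** Such a t is a 2-adic integer, given by its residues modulo 2^b. *)
Definition coherent (t : nat -> int) := forall b, (pow2 b %| t b.+1 - t b)%int.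

Lemma coherentP t b c : coherent t -> (b <= c)%N -> (pow2 b %| t c - t b)%int.
Proof.
move=> ct; elim: c => [|c IH]; first by rewrite leqn0 => /eqP ->; rewrite subrr dvdz0.
rewrite leq_eqVlt ltnS => /predU1P[->|bc]; first by rewrite subrr dvdz0.
rewrite -(subrKA (t c)); apply: rpredD; last exact: IH.
exact: dvd_pow2_trans bc (ct c).
Qed.

Definition active (t : nat -> int) (i : int) (J : nat) : bool :=
  (pow2 (spacing J) %| t (spacing J) + i)%int.

(** Positions that are active at a level are active at all lower ones, so the
levels from the first inactive one on leave the position unchanged; any
inactive level yields the same letter ([wordE]). *)
Definition word (t : nat -> int) (i : int) : option nat :=
  if pselect (exists J, ~~ active t i J) is left ex
  then symb (projT1 (cid ex)) (t (spacing (projT1 (cid ex))) + i) else None.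

Lemma wordE t i J : coherent t -> ~~ active t i J -> word t i = symb J (t (spacing J) + i).
Proof.
move=> ct nJ; rewrite /word; case: pselect => [ex|[]]; last by exists J.
case: cid => K nK /=.
suff H A B : (A <= B)%N -> ~~ active t i A ->
    symb B (t (spacing B) + i) = symb A (t (spacing A) + i).
  by have [JK|/ltnW KJ] := leqP J K; rewrite -?(H _ _ KJ nK) ?(H _ _ JK nJ).
move=> AB nA.
have AD : (pow2 (spacing A) %| (t (spacing B) + i) - (t (spacing A) + i))%int.
  by rewrite opprD addrACA subrr addr0; apply: coherentP => //; exact: spacing_homo.
rewrite (symb_stable AB) ?(symb_period AD)//.
by move: nA; rewrite /active (dvdz_pow2_congr AD).
Qed.

Lemma word_always_active t i : (forall J, active t i J) -> word t i = None.
Proof. by move=> H; rewrite /word; case: pselect => // ex; exfalso; case: ex => J; rewrite H. Qed.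

Lemma word_letter t i c j : coherent t -> word t i = Some c ->
  (offset j <= c < offset j.+1)%N -> c = letter j (t (depth j) + i).
Proof.
move=> ct wc cj.
have [J nJ] : exists J, ~~ active t i J.
  by move: wc; rewrite /word; case: pselect.
move: wc; rewrite (wordE ct nJ) => /symb_Some[j' [j'J zj' cj']].
have jj' : j = j'.
  have := letter_range j' (t (spacing J) + i); rewrite -cj' => cr.
  apply/eqP; rewrite eqn_leq; apply/andP; split; rewrite leqNgt; apply/negP => lt.
    have := offset_homo lt; lia.
  have := offset_homo lt; lia.
rewrite -jj' in j'J cj'; rewrite cj'; apply: letter_period.
rewrite opprD addrACA subrr addr0; apply: coherentP => //.
by apply: leq_trans (depth_le_spacingS j) _; exact: spacing_homo.
Qed.

Lemma word_low t i j : coherent t -> ~~ active t i j ->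
  forall c, word t i = Some c -> (c < offset j)%N.
Proof.
move=> ct nj c; rewrite (wordE ct nj) => /symb_Some[k [kj _ ->]].
have /andP[_ h] := letter_range k (t (spacing j) + i).
by apply: leq_trans h _; exact: offset_homo.
Qed.

Lemma word_active t i j : coherent t -> active t i j -> ~~ active t i j.+1 ->
  word t i = Some (letter j (t (depth j) + i)).
Proof.
move=> ct aj naj; rewrite (wordE ct naj) /=.
have -> : (pow2 (spacing j) %| t (spacing j.+1) + i)%int.
  rewrite (@dvdz_pow2_congr _ _ (t (spacing j) + i))// opprD addrACA subrr addr0.
  by apply: coherentP => //; exact: spacing_homo.
congr Some; apply: letter_period.
by rewrite opprD addrACA subrr addr0; apply: coherentP => //; exact: depth_le_spacingS.
Qed.

Lemma coherent_shift t (k : int) : coherent t -> coherent (fun b => t b - k).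
Proof. by move=> ct b; rewrite opprB addrA subrK; exact: ct. Qed.

Lemma word_shift t i (k : int) : coherent t ->
  word (fun b => t b - k) i = word t (i - k).
Proof.
move=> ct; have ct' := coherent_shift k ct.
have E J : active (fun b => t b - k) i J = active t (i - k) J.
  by rewrite /active addrAC addrA.
have [[J nJ]|nex] := pselect (exists J, ~~ active t (i - k) J).
  by rewrite (wordE ct nJ) (@wordE _ i J ct') ?E//; congr symb; rewrite addrAC addrA.
rewrite /word; case: pselect => [ex|_].
  by exfalso; case: ex => J; rewrite E => nJ; apply: nex; exists J.
by case: pselect.
Qed.

(** When the window avoids all levels above j, the letters of level j in it are
exactly the word required by [symbol_decode]. *)
Lemma word_decode j t t' : coherent t -> coherent t' ->
  (forall k, (k <= reach j)%N -> ~~ active t (- k%:Z) j.+1) ->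
  (forall k c, (k <= reach j)%N -> (offset j <= c < offset j.+1)%N ->
    word t (- k%:Z) = Some c -> word t' (- k%:Z) = Some c) ->
  (pow2 (depth j) %| t (depth j) - t' (depth j))%int.
Proof.
move=> ct ct' na H; apply: symbol_decode => i iln ti.
have ai : active t (- i%:Z) j.
  rewrite /active -(@dvdz_pow2_congr _ (t (depth j) - i%:Z))//.
  rewrite opprD opprK addrACA addNr addr0.
  by apply: coherentP => //; exact: spacing_le_depth.
have W := word_active ct ai (na _ iln).
have W' := H i _ iln (letter_range _ _) W.
by have := word_letter ct' W' (letter_range _ _); rewrite /letter => /addnI.
Qed.

End symbolic_process.

(** * A uniform random 2-adic phase *)

Section random_phase.
Context (R : realType).

Definition unif : probability (measurableTypeR R) R := uniform_prob (@ltr01 R).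

(** The uniform law does not charge the complement of [0, 1[, whose points are
sent to 0. *)
Definition unitpart (u : R) : R := if 0 <= u < 1 then u else 0.

Lemma unitpart_itv u : 0 <= unitpart u < 1.
Proof. by rewrite /unitpart; case: ifP => // _; rewrite lexx ltr01. Qed.

Definition dyadic_floor (u : R) (b : nat) : nat := Num.truncn (2 ^+ b * unitpart u).

Lemma dyadic_floorP u b c : (dyadic_floor u b == c) = (c%:R <= 2 ^+ b * unitpart u < c.+1%:R).
Proof.
have x0 : 0 <= 2 ^+ b * unitpart u.
  by rewrite mulr_ge0// ?exprn_ge0//; case/andP: (unitpart_itv u).
exact: truncn_eq.
Qed.

Lemma dyadic_floorS u b : dyadic_floor u b = (dyadic_floor u b.+1)./2.
Proof.
apply/eqP; rewrite dyadic_floorP.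
have /andP[] : (dyadic_floor u b.+1)%:R <= 2 ^+ b.+1 * unitpart u < (dyadic_floor u b.+1).+1%:R.
  by rewrite -dyadic_floorP.
set c := dyadic_floor _ _; set x := unitpart u; rewrite exprS.
have := odd_double_half c; set h := c./2 => E.
have h1 : (2 * h <= c)%N by lia.
have h2 : (c.+1 <= 2 * h.+1)%N by case: (odd c) E => /=; lia.
rewrite -(ler_nat R) natrM in h1; rewrite -(ler_nat R) natrM in h2.
by move=> H1 H2; apply/andP; split; lra.
Qed.

(** The binary digits of u with reversed significance: the first digit of u is
the lowest bit, so that the residues are coherent as b grows. *)
Fixpoint phase (u : R) (b : nat) : nat :=
  if b is b'.+1 then (phase u b' + odd (dyadic_floor u b'.+1) * 2 ^ b')%N else 0%N.

Lemma phase_lt u b : (phase u b < 2 ^ b)%N.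
Proof. by elim: b => //= b IH; rewrite expnS; case: odd; lia. Qed.

(** Reversal of bits is a bijection, so prescribing the phase modulo 2^b means
prescribing a dyadic interval for u. *)
Lemma phase_floor b e : (e < 2 ^ b)%N ->
  exists2 c, (c < 2 ^ b)%N & forall u, (phase u b == e) = (dyadic_floor u b == c).
Proof.
elim: b e => [|b IH] e eb.
  exists 0%N => // u; rewrite dyadic_floorP expr0 mul1r unitpart_itv.
  by move: eb; rewrite expn0 ltnS leqn0 => /eqP ->.
have [r [h [rb e'E]]] : exists r (h : bool), (r < 2 ^ b)%N /\ e = (r + h * 2 ^ b)%N.
  exists (e %% 2 ^ b)%N, (2 ^ b <= e)%N; split; first by rewrite ltn_mod expn_gt0.
  rewrite {1}(divn_eq e (2 ^ b)) addnC; congr (_ + _ * _)%N.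
  have : (e %/ 2 ^ b < 2)%N by rewrite ltn_divLR ?expn_gt0// -expnS.
  by rewrite -(divn_gt0 _ (expn_gt0 2 b)); case: (e %/ _)%N => [|[|]].
have [c cb cP] := IH _ rb.
exists (h + c.*2)%N; first by rewrite expnS; case: (h); lia.
move=> u /=; have := phase_lt u b; have := cP u; rewrite dyadic_floorS.
have := odd_double_half (dyadic_floor u b.+1).
set t := dyadic_floor _ _; set o := odd t; set hf := t./2; set ph := phase _ _.
move=> tE phE phlt; rewrite e'E; apply/eqP/eqP.
  move=> E; have oh : o = h.
    by move: E; case: (o); case: (h) => //=; lia.
  move: E; rewrite oh => /addIn /eqP; rewrite phE => /eqP <-.
  by rewrite -tE oh.
move=> E; have oh : o = h.
  by move: E; rewrite -tE; case: (o); case: (h) => //=; lia.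
have : hf == c by apply/eqP; move: E; rewrite -tE oh => /addnI /double_inj.
by rewrite -phE => /eqP ->; rewrite oh.
Qed.

Lemma unif_itv (x y : R) : 0 <= x -> x <= y -> y <= 1 ->
  unif `[x, y[%classic = (y - x)%:E.
Proof.
move=> x0 xy y1; rewrite /unif /uniform_prob/=.
rewrite [LHS](@eq_integral _ _ _ lebesgue_measure _ (cst 1%E)); last first.
  move=> u; rewrite inE /= in_itv/= => /andP[xu uy].
  by rewrite /uniform_pdf (le_trans x0 xu) (le_trans (ltW uy) y1) subr0 invr1.
rewrite integral_cst//= mul1e lebesgue_measure_itv/= lte_fin.
by move: xy; rewrite le_eqVlt => /predU1P[->|->]; rewrite ?ltxx ?subrr.
Qed.

Lemma unif_out : unif (~` `[0, 1[%classic) = 0%E.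
Proof. by rewrite probability_setC// unif_itv// subr0 subee. Qed.

Lemma phase_preimage b e : (e < 2 ^ b)%N -> exists2 c : nat, (c < 2 ^ b)%N &
  [set u | phase u b = e] `&` `[0, 1[%classic =
  `[c%:R * hpow b, c.+1%:R * hpow b[%classic :> set R.
Proof.
move=> eb; have [c cb cP] := phase_floor eb; exists c => //.
have p0 : 0 < 2 ^+ b :> R by exact: exprn_gt0.
have hE : hpow b = (2 ^+ b)^-1 :> R by rewrite /hpow exprVn.
apply/seteqP; split => u /=; rewrite !in_itv/=.
  move=> [/eqP pu u01]; move: pu; rewrite cP dyadic_floorP /unitpart u01.
  by rewrite hE ler_pdivrMr// ltr_pdivlMr// mulrC.
move=> H; have /andP[H1 H2] := H; have u01 : 0 <= u < 1.
  rewrite (le_trans _ H1) ?mulr_ge0 ?hpow_ge0//=; apply: lt_le_trans H2 _.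
  rewrite hE ler_pdivrMr// mul1r -natrX ler_nat//.
split => //; apply/eqP; rewrite cP dyadic_floorP /unitpart u01.
by rewrite mulrC -ler_pdivrMr// -ltr_pdivlMr// -hE.
Qed.

Lemma measurable_phase b e : measurable [set u : measurableTypeR R | phase u b = e].
Proof.
have [eb|be] := ltnP e (2 ^ b); last first.
  rewrite (_ : [set _ | _] = set0)//; apply/seteqP; split => // u /= pu.
  by have := phase_lt u b; rewrite pu ltnNge be.
have [c _ cE] := phase_preimage eb.
have out u : ~ `[0, 1[%classic u -> phase u b = phase 2 b.
  move=> nu; have D b' : dyadic_floor u b' = dyadic_floor 2 b'.
    rewrite /dyadic_floor /unitpart ifF; last by move/negP/negbTE : nu; rewrite /= in_itv.
    by rewrite ifF// [2 < 1]ltNge ler1n andbF.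
  by elim: b {eb c cE} => //= b ->; rewrite D.
rewrite -[X in measurable X](setUIDK _ `[0, 1[%classic) cE; apply: measurableU => //.
have [p2|p2] := eqVneq (phase 2 b) e.
  rewrite (_ : _ `\` _ = ~` `[0, 1[%classic); first exact: measurableC.
  by apply/seteqP; split => [u [_]//|u nu]; split => //=; rewrite out.
rewrite (_ : _ `\` _ = set0)//; apply/seteqP; split => // u /= [pu nu].
by move: p2; rewrite -(out u)// pu eqxx.
Qed.

Lemma unif_phase b e : (e < 2 ^ b)%N -> unif [set u | phase u b = e] = (hpow b)%:E.
Proof.
move=> eb; have [c cb cE] := phase_preimage eb.
have me := measurable_phase b e.
have -> : unif [set u | phase u b = e] = unif ([set u | phase u b = e] `&` `[0, 1[%classic).
  rewrite -{1}(setUIDK [set u | phase u b = e] `[0, 1[%classic) measureU0//.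
  - exact: measurableI.
  - exact: measurableD.
  apply/eqP; rewrite eq_le measure_ge0 andbT -unif_out.
  apply: le_measure; rewrite ?inE; [exact: measurableD|exact: measurableC|].
  by move=> u [].
rewrite cE unif_itv.
- by congr EFin; rewrite -natr1; ring.
- by rewrite mulr_ge0// hpow_ge0.
- by rewrite ler_wpM2r ?hpow_ge0// ler_nat.
- have p0 : 0 < 2 ^+ b :> R by exact: exprn_gt0.
  by rewrite /hpow exprVn ler_pdivrMr// mul1r -natrX ler_nat.
Qed.

End random_phase.

(** * Isolated letters and finite windows *)

Section discrete_sequences.
Context (R : realType) (M : completeMetricType R).
Implicit Type F : set M.

Lemma mball x (e : R) : ball x e = [set y : M | mdist x y < e].
Proof. exact: ballEmdist. Qed.

Lemma mdistC (x y : M) : mdist x y = mdist y x.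
Proof. exact: metric_sym. Qed.

Lemma mdist_tri (y x z : M) : mdist x z <= mdist x y + mdist y z.
Proof. exact: metric_triangle. Qed.

Lemma finite_closed F : finite_set F -> closed F.
Proof. by move=> fF; apply: compact_closed; [exact: metric_hausdorff|exact: finite_compact]. Qed.

Lemma finite_ball_disjoint F (x : M) : finite_set F -> ~ F x ->
  exists2 e : R, 0 < e & forall y, F y -> ~ ball x e y.
Proof.
move=> fF nFx; have : nbhs x (~` F).
  by apply: open_nbhs_nbhs; split => //; apply: closed_openC; exact: finite_closed.
by move=> /nbhs_ballP[e /= e0 eF]; exists e => // y Fy /eF.
Qed.

(** If M has an accumulation point, points whose distances to it decrease at
least geometrically are isolated from each other; if not, all points of M are
isolated. *)
Lemma discrete_sequence F : finite_set F -> infinite_set [set: M] ->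
  exists m : nat -> M, forall n, ~ F (m n) /\
    exists2 e : R, 0 < e & forall k, ball (m n) e (m k) -> k = n.
Proof.
move=> fF iM.
have [[p pacc]|nacc] := pselect (exists p : M, forall e : R, 0 < e ->
    exists2 x, x != p & ball p e x).
  have /choice[g gP] : forall e : R, exists x, 0 < e -> [/\ 0 < mdist p x, mdist p x < e & ~ F x].
    move=> e; have [e0|] := ltP 0 e; last by exists point.
    have fFp : finite_set (F `\ p) by exact: finite_setD.
    have [|e' e'0 e'F] := @finite_ball_disjoint (F `\ p) p fFp.
      by move=> [_]; exact.
    have m0 : 0 < Num.min e e' by rewrite lt_min e0.
    have [x xp] := pacc _ m0; rewrite mball/= lt_min => /andP[xe xe'].
    exists x => _; split => //; first by rewrite mdist_gt0 eq_sym.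
    move=> Fx; apply: (e'F x); first by split => //; exact/eqP.
    by rewrite mball.
  pose m := fix m n := if n is n'.+1 then g (mdist p (m n') / 2) else g 1.
  have m0 n : 0 < mdist p (m n) /\ ~ F (m n).
    elim: n => [|n [IH _]] /=; first by have [] := gP 1 ltr01.
    by have [] := gP (mdist p (m n) / 2) (divr_gt0 IH (ltr0n _ 2)).
  have mS n : mdist p (m n.+1) < mdist p (m n) / 2.
    by have [] := gP (mdist p (m n) / 2) (divr_gt0 (m0 n).1 (ltr0n _ 2)).
  have mlt n k : (n < k)%N -> mdist p (m k) < mdist p (m n) / 2.
    elim: k => // k IH; rewrite ltnS leq_eqVlt => /predU1P[->//|/IH h].
    apply: lt_trans (mS k) _; have := (m0 k).1; have := (m0 n).1; lra.
  exists m => n; split; first exact: (m0 n).2.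
  exists (mdist p (m n) / 2); first by rewrite divr_gt0//; exact: (m0 n).1.
  move=> k; rewrite mball/= => nk.
  have [kn|kn|//] := ltngtP k n.
    exfalso; have := mlt _ _ kn; have := mdist_tri (m n) p (m k); have := (m0 k).1.
    have := (m0 n).1; lra.
  exfalso; have := mlt _ _ kn; have := mdist_tri (m k) p (m n); rewrite (mdistC (m k)); lra.
have /infiniteP/pcard_leP[f] := infinite_setD iM fF.
have fF' n : ~ F (f n) by have [] := @funS _ _ _ _ f n Logic.I.
exists f => n; split; first exact: fF'.
move/forallNP : nacc => /(_ (f n)) /existsNP[e /not_implyP[e0 he]].
exists e => // k fnk; apply: contrapT => kn; apply: he; exists (f k) => //.
apply/eqP => fkn; apply: kn.
by apply: (@inj _ _ setT f); rewrite ?inE.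
Qed.

End discrete_sequences.

Section compact_moduli.
Context (R : realType) (M : completeMetricType R).
Local Notation X := (bilateral_product M).

Lemma nbhs_window (x : X) (a : nat) (e : R) : 0 < e ->
  nbhs x [set z : X | forall i : int, (`|i| <= a)%N -> ball (x i) e (z i)].
Proof.
move=> e0.
have H (j : 'I_(a + a).+1) : nbhs x [set z : X | ball (x (Posz j - Posz a)) e (z (Posz j - Posz a))].
  by apply: (@bilateral_proj_continuous R M (Posz j - Posz a) x); exact: nbhsx_ballx.
have := @filter_forall _ _ (fun (j : 'I_(a + a).+1) =>
  [set z : X | ball (x (Posz j - Posz a)) e (z (Posz j - Posz a))]) (nbhs x) (nbhs_filter x) H.
apply: filterS => z /= Hz i ia.
have ja : (absz (i + Posz a)%R < (a + a).+1)%N by lia.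
have := Hz (Ordinal ja) => /=.
by have -> : Posz (absz (i + Posz a)%R) - Posz a = i by lia.
Qed.

(** The sequences over B form a compact set, on which U holds locally uniformly.
A sequence with entries in B on the window only agrees there with a sequence
over B, and neighbourhoods constrain finitely many coordinates. *)
Lemma compact_window (B : set M) (U : X -> nat -> Prop) :
  finite_set B -> B !=set0 ->
  (forall z n n', (n <= n')%N -> U z n -> U z n') ->
  (forall x : X, (forall i, B (x i)) -> exists n, nbhs x [set z | U z n]) ->
  exists a, forall z : X, (forall i : int, (`|i| <= a)%N -> B (z i)) -> U z a.
Proof.
move=> fB [b0 Bb0] Umono Uloc.
have cK : compact [set x : X | forall i, B (x i)].
  exact: (@tychonoff int (fun=> M) (fun=> B) (fun=> finite_compact fB)).
move/compact_near_coveringP : cK.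
move=> /(_ nat \oo (fun n x' => forall z : X,
   (forall i : int, (`|i| <= n)%N -> z i = x' i) -> U z n)) H.
have [|N _ HN] := H _.
  move=> x Bx; have [n xn] := Uloc x Bx.
  have [a aU] := bilateral_nbhs xn.
  exists ([set z : X | forall i : int, (`|i| <= a)%N -> ball (x i) (hpow a) (z i)],
          [set k | (maxn a n <= k)%N]) => /=.
    split; first by apply: nbhs_window; exact: hpow_gt0.
    by exists (maxn a n).
  move=> [x' k] /= [x'a]; rewrite geq_max => /andP[ak nk] z zx'.
  apply: Umono nk _; apply: aU => i ia; rewrite zx'; first exact: x'a.
  exact: leq_trans ak.
exists N => z Bz; pose x' : X := fun i => if (`|i| <= N)%N then z i else b0.
apply: (HN N (leqnn N) x').
  by move=> i; rewrite /x'; case: ifPn => // /Bz.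
by move=> i iN; rewrite /x' iN.
Qed.

Variable d : X -> X -> R.
Hypothesis dc : compatible_metric d.

(** A compatible metric gives no explicit control on coordinates; compactness
makes continuity of the coordinate 0 uniform over the sequences whose entries
on a finite window belong to B. *)
Lemma isolated_modulus (B : set M) (m : M) (e : R) : finite_set B -> B !=set0 -> 0 < e ->
  exists a, forall z w : X, (forall i : int, (`|i| <= a)%N -> B (z i)) ->
    d z w <= hpow a -> z 0 = m -> ball m e (w 0).
Proof.
move=> fB B0 e0; pose U (z : X) n := forall w : X, d z w <= hpow n -> z 0 = m -> ball m e (w 0).
have [||a aU] := @compact_window B U fB B0.
- move=> z n n' nn' H w zw; apply: H; apply: le_trans zw _.
  by rewrite ler_hpow.
- move=> x _; have [xm|xm] := pselect (x 0 = m); last first.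
    exists 0%N; have : nbhs (x 0) (~` [set m]).
      apply: open_nbhs_nbhs; split; last exact: xm.
      by apply: closed_openC; exact: (finite_closed (finite_set1 m)).
    move/(@bilateral_proj_continuous R M 0 x) => H.
    have {}H : nbhs x [set z : X | z 0 <> m] by exact: H.
    by apply: filterS H => z /= zm w _ /zm.
  have /(compatible_metric_nbhs dc)[e' e'0 He'] : nbhs x [set z : X | ball m e (z 0)].
    by apply: (@bilateral_proj_continuous R M 0 x); rewrite xm; exact: nbhsx_ballx.
  have [n _ ne] := ex_hpow_lt 0 e'0; exists n.+1.
  apply: filterS (nbhs_cmetric_ball dc x (hpow_gt0 R n.+1)) => z /= xz w zw _.
  apply: He' => /=; apply: le_lt_trans (cmetric_triangle dc z x w) _.
  apply: lt_trans ne; rewrite (hpowS _ n); lra.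
by exists a => z w Bz zw; exact: aU.
Qed.

End compact_moduli.

(** * Quantisation, iterated shifts and phase events *)

Section quantization.
Context (R : realType) (M : completeMetricType R).
Local Notation X := (bilateral_product M).
Variable q : nat -> M.

Fixpoint quantize (n : nat) (y : M) : M :=
  if n is n'.+1 then
    if mdist y (q n) < mdist y (quantize n' y) then q n else quantize n' y
  else q 0.

Lemma quantize_range n y : exists2 k, (k <= n)%N & quantize n y = q k.
Proof.
elim: n => [|n [k kn qk]] /=; first by exists 0%N.
by case: ifP => _; [exists n.+1|exists k => //; exact: leqW].
Qed.

Lemma finite_quantize n : finite_set (range (quantize n)).
Proof.
apply: (@sub_finite_set _ _ (q @` [set k | (k < n.+1)%N])).
  by move=> _ [y _ <-]; have [k kn ->] := quantize_range n y; exists k.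
by apply: finite_image; exact: finite_II.
Qed.

Lemma mdist_quantize n k y : (k <= n)%N -> mdist y (quantize n y) <= mdist y (q k).
Proof.
elim: n => [|n IH] /=; first by rewrite leqn0 => /eqP ->.
rewrite leq_eqVlt ltnS => /predU1P[->|kn]; first by case: ltP => // /ltW.
by case: ifP => [/ltW /le_trans|_]; [apply; exact: IH|exact: IH].
Qed.

Lemma quantize_cvg y : closure (range q) y -> quantize n y @[n --> \oo] --> y.
Proof.
move=> yq; apply/cvg_ballP => e e0.
have [_ [[k _ <-] yk]] := yq _ (nbhsx_ballx y e e0).
exists k => // n /= kn; rewrite mball/=; apply: le_lt_trans (mdist_quantize y kn) _.
by move: yk; rewrite mball.
Qed.

Lemma measurable_coord_open (i : int) (A : set M) : open A ->
  measurable [set x : borel X | A (x i)].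
Proof.
move=> oA; apply: (@borel_open X).
by have /continuousP := @bilateral_proj_continuous R M i; apply.
Qed.

Lemma measurable_quantize n i (S : set M) :
  measurable [set x : borel X | S (quantize n (x i))].
Proof.
elim: n S => [|n IH] S /=.
  have [Sq|nSq] := pselect (S (q 0)).
    by rewrite (_ : [set _ | _] = setT)//; apply/seteqP; split.
  by rewrite (_ : [set _ | _] = set0)//; apply/seteqP; split.
pose D k := [set x : borel X | mdist (x i) (q n.+1) < mdist (x i) (q k)].
have mD k : measurable (D k).
  apply: (@measurable_coord_open i [set y | mdist y (q n.+1) < mdist y (q k)]).
  rewrite openE => y /= yk; apply/nbhs_ballP.
  exists ((mdist y (q k) - mdist y (q n.+1)) / 2) => /=; first by rewrite divr_gt0// subr_gt0.
  move=> z; rewrite mball/= => yz.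
  have := mdist_tri y z (q n.+1); have := mdist_tri z y (q k).
  rewrite (mdistC z y); lra.
pose E k := [set x : borel X | quantize n (x i) = q k].
rewrite (_ : [set _ | _] = \bigcup_k (E k `&` ((D k `&` [set x | S (q n.+1)]) `|`
   (~` D k `&` [set x | S (quantize n (x i))])))); last first.
  apply/seteqP; split => x /=.
    have [k _ xk] := quantize_range n (x i); rewrite xk => H; exists k => //; split => //.
    rewrite /D /= xk; case: ltP H => [xD SD|xD SD]; [by left|right; split => //].
  by move=> [k _ [xk]]; rewrite /D /= xk => -[[-> //]|[/negP/negbTE -> //]].
apply: bigcupT_measurable => k; apply: measurableI; first exact: (IH [set q k]).
apply: measurableU; apply: measurableI => //.
- have [Sq|nSq] := pselect (S (q n.+1)).
    by rewrite (_ : [set _ | _] = setT)//; apply/seteqP; split.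
  by rewrite (_ : [set _ | _] = set0)//; apply/seteqP; split.
- exact: measurableC.
Qed.

End quantization.

Section shift_iterates.
Context (R : realType) (M : completeMetricType R).
Local Notation X := (bilateral_product M).
Local Notation T := (@full_shift M).

Lemma iter_shiftE k (x : X) i : iter k T x i = x (i - k%:Z).
Proof.
elim: k i => [|k IH] i; first by rewrite subr0.
by rewrite iterS /full_shift IH; congr x; lia.
Qed.

Lemma iter_shift_lipschitz (d : X -> X -> R) (lam : nat) :
  (forall x y, d (T x) (T y) <= 2 ^+ lam * d x y) ->
  forall k x y, d (iter k T x) (iter k T y) <= 2 ^+ (lam * k) * d x y.
Proof.
move=> HT; elim=> [|k IH] x y; first by rewrite muln0 expr0 mul1r.
rewrite !iterS; apply: le_trans (HT _ _) _.
by rewrite mulnS exprD -mulrA ler_wpM2l ?exprn_ge0.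
Qed.

End shift_iterates.

Section phase_events.
Context (R : realType).

Definition adic_phase (u : R) (b : nat) : int := (phase u b)%:Z.

Lemma coherent_phase u : coherent (adic_phase u).
Proof.
move=> b; rewrite /adic_phase /= PoszD addrAC subrr add0r PoszM.
have -> : (2 ^ b)%N%:Z = pow2 b by rewrite /pow2 -natz natrX.
exact: dvdz_mull.
Qed.

Lemma measurable_phase_pred b (S : set nat) :
  measurable [set u : measurableTypeR R | S (phase u b)].
Proof.
rewrite (_ : [set _ | _] = \bigcup_(e in S) [set u | phase u b = e]).
  by apply: bigcup_measurable => e _; exact: measurable_phase.
by apply/seteqP; split => [u Su|u [e Se /= ->]//]; exists (phase u b).
Qed.

Lemma unif_divisible b (i : int) :
  (unif R [set u | (pow2 b %| (adic_phase u b + i)%R)%int] <= (hpow b)%:E)%E.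
Proof.
pose e := absz (modz (- i) (pow2 b)).
have e0 : 0 <= modz (- i) (pow2 b) by rewrite modz_ge0// pow2_neq0.
have P2 : pow2 b = (2 ^ b)%N by rewrite /pow2 -natz natrX.
have eb : (e < 2 ^ b)%N.
  by rewrite -ltz_nat -P2 /e gez0_abs// ltz_pmod ?pow2_gt0.
rewrite -(unif_phase R eb); apply: le_measure; rewrite ?inE.
- exact: (measurable_phase_pred b [set e | (pow2 b %| e%:Z + i)%int]).
- exact: measurable_phase.
move=> u /=; rewrite /adic_phase -[i]opprK -eqz_mod_dvd => /eqP ui.
apply/eqP; rewrite -eqz_nat /e gez0_abs// -ui modz_small//.
by rewrite P2 /= ltz_nat phase_lt.
Qed.

End phase_events.

(** * The coded process and its invariance *)

Section coded_process.
Context (R : realType) (M : completeMetricType R).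
Local Notation X := (bilateral_product M).
Local Notation T := (@full_shift M).
Local Notation MT := (invariant_probability R T).
Variables (lam : nat) (modulus : nat -> nat) (v0 : nat).
Local Notation spacing := (spacing lam modulus v0).
Local Notation symb := (symb lam modulus v0).
Local Notation word := (word lam modulus v0).
Local Notation active := (active lam modulus v0).
Variables (pr : M -> M) (m : nat -> M).
Hypothesis mpr : forall i (S : set M), measurable [set x : borel X | S (pr (x i))].
Variable mu : MT.

Definition decode (w : option nat) (y : M) : M := if w is Some c then m c else pr y.

Definition coded (x : X) (u : R) : X := fun i => decode (word (adic_phase u) i) (x i).

Lemma codedE x u i : coded x u i = decode (word (adic_phase u) i) (x i).
Proof. by []. Qed.

(** The coded process with its levels below J only, as a function of the phase
modulo 2^(spacing J). *)
Definition truncated (J : nat) (x : X) (e : int) : X :=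
  fun i => decode (symb J (e + i)) (x i).

Local Notation P := (prob_of mu \x unif R)%E.

Lemma measurable_word i w :
  measurable [set u : measurableTypeR R | word (adic_phase u) i = w].
Proof.
pose A J (S : bool -> option nat -> Prop) := [set u : measurableTypeR R |
  S (active (adic_phase u) i J) (symb J (adic_phase u (spacing J) + i))].
have mA J S : measurable (A J S).
  exact: (measurable_phase_pred (spacing J)
    [set e | S (pow2 (spacing J) %| e%:Z + i)%int (symb J (e%:Z + i))]).
rewrite (_ : [set _ | _] = (\bigcup_J A J (fun a s => ~~ a /\ s = w)) `|`
    (\bigcap_J A J (fun a s => a /\ w = None))).
  by apply: measurableU; [exact: bigcupT_measurable|exact: bigcapT_measurable].
apply/seteqP; split => u /=.
  move=> uw; have [[J nJ]|nex] := pselect (exists J, ~~ active (adic_phase u) i J).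
    by left; exists J => //; split => //; rewrite -(wordE (coherent_phase u) nJ).
  right => J _; split.
    by apply: contrapT => /negP nJ; apply: nex; exists J.
  rewrite -uw word_always_active// => K.
  by apply: contrapT => /negP nK; apply: nex; exists K.
case=> [[J _ [nJ sw]]|H]; first by rewrite (wordE (coherent_phase u) nJ).
have [_ ->] := H 0%N Logic.I; rewrite word_always_active// => J.
by have [] := H J Logic.I.
Qed.

Lemma measurable_decode (f : R -> option nat) i (S : set M) :
  (forall w, measurable [set u : measurableTypeR R | f u = w]) ->
  measurable [set xu : borel X * measurableTypeR R | S (decode (f xu.2) (xu.1 i))].
Proof.
move=> mf.
rewrite (_ : [set _ | _] = ([set x : borel X | S (pr (x i))] `*` [set u | f u = None]) `|`
   \bigcup_(c in [set c | S (m c)]) (setT `*` [set u | f u = Some c])).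
  apply: measurableU; first exact: measurableX.
  by apply: bigcup_measurable => c _; exact: measurableX.
apply/seteqP; split => [[x u]|[x u]] /=.
  by case E : (f u) => [c|] /= H; [right; exists c|left].
by case=> [[H ->]//|[c Sc [_ /= ->]]].
Qed.

Variable O : nat -> set M.
Hypothesis bO : countable_base O.

Lemma measurable_coded : measurable_fun setT
  (fun xu : borel X * measurableTypeR R => coded xu.1 xu.2 : borel X).
Proof.
apply: (coord_measurable (f := fun xu : borel X * measurableTypeR R => coded xu.1 xu.2) bO).
move=> i n; apply: (@measurable_decode (fun u => word (adic_phase u) i) i (O n)).
by move=> w; exact: measurable_word.
Qed.

Lemma measurable_truncated J e : measurable_fun setT
  (fun x : borel X => truncated J x e : borel X).
Proof.
apply: (coord_measurable (f := fun x : borel X => truncated J x e) bO).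
move=> i n /=; rewrite /truncated; case: (symb J (e + i)) => [c|] /=; last exact: mpr.
have [Sq|nSq] := pselect (O n (m c)).
  by rewrite (_ : [set _ | _] = setT)//; apply/seteqP; split.
by rewrite (_ : [set _ | _] = set0)//; apply/seteqP; split.
Qed.

Definition coded_law : probability (borel X) R :=
  distribution P (mfun_Sub (mem_set measurable_coded)).

Lemma coded_lawE A : coded_law A = P [set xu | A (coded xu.1 xu.2)].
Proof. by []. Qed.

Lemma measurable_active J (i : int) :
  measurable [set u : measurableTypeR R | active (adic_phase u) i J].
Proof. exact: (measurable_phase_pred (spacing J) [set e | (pow2 (spacing J) %| e%:Z + i)%int]). Qed.

Lemma unif_active J (l : seq int) :
  let A := [set u : measurableTypeR R | exists2 i, i \in l & active (adic_phase u) i J] in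
  measurable A /\ (unif R A <= ((size l)%:R * hpow (spacing J))%:E)%E.
Proof.
elim: l => [|i l [mA A1]] /=.
  rewrite (_ : [set _ | _] = set0); last by apply/seteqP; split => u // -[].
  by rewrite measure0 mul0r.
rewrite (_ : [set _ | _] = [set u | active (adic_phase u) i J] `|`
    [set u | exists2 i, i \in l & active (adic_phase u) i J]); last first.
  apply/seteqP; split => u /=.
    by case=> k; rewrite in_cons => /predU1P[->|kl] ak; [left|right; exists k].
  by case=> [ai|[k kl ak]]; [exists i; rewrite ?mem_head|exists k; rewrite ?in_cons ?kl ?orbT].
have mi := measurable_active J i.
split; first exact: measurableU.
apply: le_trans (measureU2 _ _ _) _ => //.
rewrite -natr1 mulrDl mul1r addrC EFinD; apply: leeD => //; exact: unif_divisible.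
Qed.

Definition truncated_law J (A : set (borel X)) : \bar R :=
  P [set xu | A (truncated J xu.1 (adic_phase xu.2 (spacing J)))].

Lemma measurable_truncated_phase J (A : set (borel X)) : measurable A ->
  measurable [set xu : borel X * measurableTypeR R |
    A (truncated J xu.1 (adic_phase xu.2 (spacing J)))].
Proof.
move=> mA; rewrite (_ : [set _ | _] = \bigcup_e
   ([set x | A (truncated J x e%:Z)] `*` [set u | phase u (spacing J) = e])).
  apply: bigcupT_measurable => e; apply: measurableX; last exact: measurable_phase.
  by rewrite -[X in measurable X]setTI; exact: (measurable_truncated J e%:Z).
apply/seteqP; split => [[x u] /= H|[x u] [e _ [/= H E]]].
  by exists (phase u (spacing J)).
by rewrite /adic_phase E.
Qed.

Lemma truncated_lawE J (A : set (borel X)) : measurable A ->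
  truncated_law J A = (\sum_(e < 2 ^ spacing J)
    prob_of mu [set x | A (truncated J x e%:Z)] * (hpow (spacing J))%:E)%E.
Proof.
move=> mA; pose B e := ([set x : borel X | A (truncated J x e%:Z)] `*`
  [set u : measurableTypeR R | phase u (spacing J) = e]).
have mAe e : measurable [set x : borel X | A (truncated J x e)].
  by rewrite -[X in measurable X]setTI; exact: (measurable_truncated J e).
rewrite /truncated_law (_ : [set _ | _] = \big[setU/set0]_(e < 2 ^ spacing J) B e).
  rewrite measure_bigsetU//=; last 2 first.
  - by move=> e; apply: measurableX => //; exact: measurable_phase.
  - by move=> e e' _ _ [[x u] [[_ /= <-] [_ /= <-]]].
  apply: eq_bigr => e _; rewrite product_measure1E//; last exact: measurable_phase.
  by rewrite -(unif_phase R (ltn_ord e)).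
rewrite -bigcup_mkord.
apply/seteqP; split => [[x u] /= H|[x u] [e _ [/= H E]]].
  by exists (phase u (spacing J)) => //; exact: phase_lt.
by rewrite /adic_phase E.
Qed.

Lemma shift_truncated J x e : T (truncated J x e) = truncated J (T x) (e - 1).
Proof.
by apply/funext => i; rewrite /full_shift /truncated; congr decode; congr symb; ring.
Qed.

Lemma truncated_period J x (e : int) : truncated J x (e + pow2 (spacing J)) = truncated J x e.
Proof.
apply/funext => i; rewrite /truncated; congr decode; apply: symb_period.
by rewrite (_ : _ - _ = pow2 (spacing J)) ?dvdzz//; ring.
Qed.

(** The shift maps the residue e to e - 1 and x to a point with the same law; the
residues being equally likely, they are only permuted. *)
Lemma truncated_law_shift J (A : set (borel X)) :
  measurable (T @^-1` A : set (borel X)) -> measurable A ->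
  truncated_law J (T @^-1` A) = truncated_law J A.
Proof.
move=> mTA mA; rewrite !truncated_lawE//.
pose g e := (prob_of mu [set x | A (truncated J x e)] * (hpow (spacing J))%:E)%E.
have E e : (prob_of mu [set x | (T @^-1` A) (truncated J x e)] * (hpow (spacing J))%:E)%E = g (e - 1).
  rewrite /g; congr (_ * _)%E.
  rewrite -(set_mem (valP (mu : invariant_measures T)) [set x | A (truncated J x (e - 1))]).
    by congr (prob_of mu _); apply/seteqP; split => x /=; rewrite shift_truncated.
  by rewrite -[X in measurable X]setTI; exact: (measurable_truncated J (e - 1)).
under eq_bigr do rewrite E.
have gp : g (pow2 (spacing J) - 1) = g (- 1).
  by rewrite /g; congr (_ * _)%E; congr (prob_of mu _); apply/seteqP; split => x /=;
    rewrite addrC truncated_period.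
have [n nE] : exists n, (2 ^ spacing J = n.+1)%N.
  by exists (2 ^ spacing J).-1; rewrite prednK// expn_gt0.
have pn : pow2 (spacing J) - 1 = n%:Z.
  have -> : pow2 (spacing J) = (2 ^ spacing J)%N%:Z by rewrite /pow2 -natz natrX.
  by rewrite nE; lia.
rewrite nE big_ord_recl big_ord_recr /= addeC sub0r -gp pn; congr (_ + _)%E.
by apply: eq_bigr => i _; congr g; rewrite /bump /=; lia.
Qed.

Lemma coded_truncated (s : seq (int * nat)) x u J :
  ~ (exists2 i, i \in map fst s & active (adic_phase u) i J) ->
  in_box O s (coded x u) <-> in_box O s (truncated J x (adic_phase u (spacing J))).
Proof.
move=> na; suff E i n : (i, n) \in s -> coded x u i = truncated J x (adic_phase u (spacing J)) i.
  by split => H i n inn; have := H i n inn; rewrite (E i n).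
move=> inn; rewrite /coded /truncated (wordE (coherent_phase u) (J := J))//.
by apply/negP => ai; apply: na; exists i => //; apply/mapP; exists (i, n).
Qed.

Lemma measurable_in_box s : measurable (in_box O s : set (borel X)).
Proof. by apply: (@borel_open X); apply: open_in_box; exact: bO.1. Qed.

Lemma measurable_coded_set (A : set (borel X)) : measurable A ->
  measurable [set xu : borel X * measurableTypeR R | A (coded xu.1 xu.2)].
Proof. by move=> mA; rewrite -[X in measurable X]setTI; exact: measurable_coded. Qed.

(** The coded point and its truncation differ on a coordinate only where level J
is active. *)
Lemma coded_law_truncated s J (eps := (((size s)%:R * hpow (spacing J))%:E : \bar R)) :
  (coded_law (in_box O s) <= truncated_law J (in_box O s) + eps)%E /\
  (truncated_law J (in_box O s) <= coded_law (in_box O s) + eps)%E.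
Proof.
have mb := measurable_in_box s.
have mt := measurable_truncated_phase J mb.
have mc := measurable_coded_set mb.
have [mA A1] := unif_active J (map fst s).
set A := [set u | _] in mA A1.
have mTA : measurable ([set: borel X] `*` A) by exact: measurableX.
have A2 : (P (setT `*` A) <= eps)%E.
  rewrite product_measure1E//= probability_setT mul1e.
  by rewrite size_map in A1.
have step (B C : set (borel X * measurableTypeR R)) : measurable B -> measurable C ->
    B `<=` C `|` (setT `*` A) -> (P B <= P C + eps)%E.
  move=> mB mC BC; apply: (@le_trans _ _ (P (C `|` (setT `*` A)))).
    by apply: le_measure; rewrite ?inE//; exact: measurableU.
  apply: le_trans (measureU2 _ _ _) _ => //; exact: leeD.
rewrite coded_lawE /truncated_law; split; apply: step => // -[x u] /= H.
  have [Au|nAu] := pselect (A u); [by right|left; exact/(coded_truncated x nAu)].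
have [Au|nAu] := pselect (A u); [by right|left; exact/(coded_truncated x nAu)].
Qed.

Lemma shift_in_box s : T @^-1` in_box O s = in_box O [seq (a.1 - 1, a.2) | a <- s].
Proof.
apply/seteqP; split => z /= H i n.
  by move=> /mapP[[k l] kl [-> ->]]; exact: H kl.
by move=> inn; apply: (H (i - 1) n); apply/mapP; exists (i, n).
Qed.

(** Truncated laws are exactly invariant, and approximate the coded law on boxes
as J grows. *)
Lemma coded_law_shift_box s : coded_law (T @^-1` in_box O s) = coded_law (in_box O s).
Proof.
have mT := measurable_in_box [seq (a.1 - 1, a.2) | a <- s].
have B J := coded_law_truncated s J.
have BT J := coded_law_truncated [seq (a.1 - 1, a.2) | a <- s] J.
have E J := @truncated_law_shift J (in_box O s).
rewrite -shift_in_box size_map in BT mT.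
have {}E J := E J mT (measurable_in_box s).
have small e : 0 < e -> exists J, (size s)%:R * hpow (spacing J) <= e / 2 :> R.
  move=> e0; have s0 : 0 < (size s).+1%:R :> R by rewrite ltr0n.
  have [n _ ne] := ex_hpow_lt 0 (divr_gt0 (divr_gt0 e0 (ltr0Sn R 1)) s0).
  exists n; move: ne; rewrite ltr_pdivlMr// => /ltW; apply: le_trans.
  rewrite mulrC ler_pM ?hpow_ge0 ?ler0n ?ler_nat// ler_hpow//.
  by apply: leq_trans (spacing_ge lam modulus v0 n); exact: leq_addl.
apply/eqP; rewrite eq_le; apply/andP; split; apply/lee_addgt0Pr => e e0;
  have [J Je] := small e e0; rewrite -lee_fin in Je;
  have [B1 B2] := B J; have [BT1 BT2] := BT J; rewrite E in BT1 BT2.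
  apply: le_trans BT1 _; apply: le_trans (leeD2r _ B2) _.
  by rewrite -addeA [in leRHS](splitr e) EFinD leeD2l// leeD.
apply: le_trans B1 _; apply: le_trans (leeD2r _ BT2) _.
by rewrite -addeA [in leRHS](splitr e) EFinD leeD2l// leeD.
Qed.

Lemma measurable_shift : measurable_fun setT (T : borel X -> borel X).
Proof.
apply: (coord_measurable (f := T : borel X -> X) bO) => i n.
by apply: (measurable_coord_open (i - 1) (A := O n)); exact: bO.1.
Qed.

Lemma coded_law_invariant (A : set (borel X)) : measurable A ->
  coded_law (T @^-1` A) = coded_law A.
Proof.
move=> mA.
exact: (box_measure_unique (P := distribution coded_law (mfun_Sub (mem_set measurable_shift)))
  (Q := coded_law) bO coded_law_shift_box mA).
Qed.

Definition coded_measure : MT := exist _ coded_law (mem_set coded_law_invariant).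

End coded_process.

(** * Reading the phase off a ball *)

Section coding_reading.
Context (R : realType) (M : completeMetricType R).
Local Notation X := (bilateral_product M).
Local Notation T := (@full_shift M).
Local Notation MT := (invariant_probability R T).
Variables (d : X -> X -> R) (lam : nat) (modulus : nat -> nat) (v0 : nat).
Hypothesis dc : compatible_metric d.
Hypothesis lam0 : (0 < lam)%N.
Hypothesis shift_exp : forall x y, d (T x) (T y) <= 2 ^+ lam * d x y.
Local Notation spacing := (spacing lam modulus v0).
Local Notation offset := (offset lam modulus v0).
Local Notation depth := (depth lam modulus v0).
Local Notation reach := (reach lam modulus v0).
Local Notation scale := (scale lam modulus v0).
Local Notation word := (word lam modulus v0).
Local Notation active := (active lam modulus v0).
Variables (pr : M -> M) (m : nat -> M).
Hypothesis m_inj : injective m.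
Hypothesis pr_m : forall y c, pr y != m c.
(** Letters of index below o are recognised at distance 2^-(modulus o) among
all coded points, if no letters of higher index occur in the window. *)
Hypothesis letters_rigid : forall o c (z w : X), (c < o)%N ->
  (forall i : int, (`|i| <= modulus o)%N ->
     range pr (z i) \/ exists2 c', (c' < o)%N & z i = m c') ->
  d z w <= hpow (modulus o) -> z 0 = m c ->
  range pr (w 0) \/ range m (w 0) -> w 0 = m c.
Local Notation coded := (coded lam modulus v0 pr m).

(** No letter of a level above j disturbs the window in which level j is read. *)
Definition legible j (u : R) := forall i : int,
  - (reach j + modulus (offset j.+1))%N%:Z <= i <= (modulus (offset j.+1))%:Z ->
  ~~ active (adic_phase u) i j.+1.

Lemma coded_low x u i j : ~~ active (adic_phase u) i j ->
  range pr (coded x u i) \/ exists2 c, (c < offset j)%N & coded x u i = m c.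
Proof.
move=> na; rewrite codedE.
have := word_low (coherent_phase u) na; case: (word _ i) => [c|] H /=.
  by right; exists c => //; exact: H.
by left; exists (x i).
Qed.

Lemma coded_range x u i : range pr (coded x u i) \/ range m (coded x u i).
Proof.
rewrite codedE; case: (word _ i) => [c|] /=; first by right; exists c.
by left; exists (x i).
Qed.

Lemma coded_letter x u i c : coded x u i = m c -> word (adic_phase u) i = Some c.
Proof.
rewrite codedE; case: (word _ i) => [c'|] /= H; first by rewrite (m_inj H).
by have := pr_m (x i) c; rewrite H eqxx.
Qed.

(** Iterating the shift over the window costs a factor 2^(lam * reach j) in the
distance, which [scale j] allows for; so the letters of level j in the window
of [coded x u] reappear in the other point, whose phase is shifted by k. *)
Lemma coded_close j k x u x' u' : legible j u ->
  d (coded x u) (iter k T (coded x' u')) <= hpow (scale j) ->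
  (pow2 (depth j) %| adic_phase u (depth j) - (adic_phase u' (depth j) - k%:Z))%int.
Proof.
move=> good close.
apply: (@word_decode lam modulus v0 j (adic_phase u) (fun b => adic_phase u' b - k%:Z)).
- exact: coherent_phase.
- by apply: coherent_shift; exact: coherent_phase.
- by move=> l ll; apply: good; lia.
move=> l c ll /andP[_ cl] wc.
rewrite word_shift; last exact: coherent_phase.
apply: (@coded_letter x'); rewrite -iter_shiftE.
set z := iter k T _; have -> : z (- l%:Z) = iter l T z 0 by rewrite iter_shiftE sub0r.
apply: (@letters_rigid (offset j.+1) c (iter l T (coded x u))) => //.
- move=> i ia; rewrite iter_shiftE; apply: coded_low; apply: good; lia.
- apply: le_trans (iter_shift_lipschitz shift_exp l _ _) _.
  apply: le_trans (ler_wpM2l _ close) _; first exact: exprn_ge0.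
  have -> : scale j = (modulus (offset j.+1) + lam * reach j)%N by [].
  rewrite hpowD mulrCA -[leRHS]mulr1 ler_wpM2l ?hpow_ge0//.
  rewrite /hpow exprVn ler_pdivrMr ?exprn_gt0// mul1r.
  by rewrite ler_eXn2l ?ltr1n// leq_mul2l ll orbT.
- by rewrite iter_shiftE sub0r codedE wc.
- by rewrite iter_shiftE /z iter_shiftE; exact: coded_range.
Qed.

Definition illegible j : set (measurableTypeR R) := [set u | ~ legible j u].

Lemma illegible_small j :
  measurable (illegible j) /\ (unif R (illegible j) <= (hpow j)%:E)%E.
Proof.
pose n := (reach j + 2 * modulus (offset j.+1) + 1)%N.
pose l := [seq (k%:Z - (reach j + modulus (offset j.+1))%N%:Z)%R | k <- iota 0 n].
have [mA A1] := unif_active R lam modulus v0 j.+1 l.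
rewrite (_ : illegible j = [set u | exists2 i, i \in l & active (adic_phase u) i j.+1]).
  split => //; apply: le_trans A1 _; rewrite lee_fin size_map size_iota.
  have -> : spacing j.+1 = (depth j + j + n)%N by rewrite spacingS /n; lia.
  rewrite hpowD mulrCA -[leRHS]mulr1 ler_pM ?hpow_ge0 ?mulr_ge0 ?hpow_ge0//.
    by rewrite ler_hpow// leq_addl.
  rewrite /hpow exprVn ler_pdivrMr ?exprn_gt0// mul1r -natrX ler_nat.
  exact: ltnW (ltn_expl _ _).
apply/seteqP; split => u /=.
  move=> nl; apply: contrapT => nex; apply: nl => i ii; apply/negP => ai.
  apply: nex; exists i => //; apply/mapP.
  exists (absz (i + (reach j + modulus (offset j.+1))%N%:Z)%R); rewrite ?mem_iota /n; lia.
move=> [i /mapP[k]]; rewrite mem_iota => kn -> ai nl.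
by have /negP := nl (k%:Z - (reach j + modulus (offset j.+1))%N%:Z) ltac:(lia).
Qed.

Variable mu : MT.
Hypothesis mpr : forall i (S : set M), measurable [set x : borel X | S (pr (x i))].
Variable O : nat -> set M.
Hypothesis bO : countable_base O.
Local Notation nu := (coded_law lam modulus v0 m mpr mu bO).
Local Notation P := (prob_of mu \x unif R)%E.

(** The events of illegibility have probability tending to 0, so almost every u
is legible at some level beyond j0. *)
Lemma coded_law_null j0 (A : set (borel X)) : measurable A ->
  (forall j x u, (j0 <= j)%N -> legible j u -> ~ A (coded x u)) -> nu A = 0%E.
Proof.
move=> mA H.
pose B := \bigcap_(j in [set j | (j0 <= j)%N]) illegible j.
have mB : measurable B.
  by apply: bigcap_measurableType => j _; case: (illegible_small j).
have B0 : unif R B = 0%E.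
  apply/eqP; rewrite eq_le measure_ge0 andbT; apply/lee_addgt0Pr => e e0.
  have [j j0j je] := ex_hpow_lt j0 e0.
  have [mi i1] := illegible_small j.
  rewrite add0e; apply: (@le_trans _ _ (unif R (illegible j))).
    by apply: le_measure; rewrite ?inE// => u; apply.
  by apply: le_trans i1 _; rewrite lee_fin ltW.
apply/eqP; rewrite eq_le measure_ge0 andbT.
have -> : 0%E = P (setT `*` B) by rewrite product_measure1E//= B0 mule0.
rewrite coded_lawE; apply: le_measure; rewrite ?inE.
- exact: (measurable_coded_set lam modulus v0 m mpr bO).
- exact: measurableX.
by move=> [x u] /= Axu; split => // j j0j lj; exact: (H j x u).
Qed.

(** The ball of radius 2^-(scale j) around a legible point prescribes the phase
modulo 2^(depth j). *)
Lemma coded_law_thick a n : nu (thick d nu a n) = 0%E.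
Proof.
apply: (@coded_law_null (maxn a n)).
  by apply: (@borel_closed X); exact: closed_thick.
move=> j x u; rewrite geq_max => /andP[aj nj] lj.
move=> /(_ (scale j) (leq_trans nj (scale_ge _ _ j lam0))).
apply/negP; rewrite -ltNge.
have small : ((hpow (depth j))%:E < (hpow (scale j * a) : R)%:E)%E.
  rewrite lte_fin ltNge ler_hpow -ltnNge.
  by apply: leq_ltn_trans (scale_lt_depth lam modulus v0 j); rewrite leq_mul2l aj orbT.
pose D := [set u' : measurableTypeR R |
  (pow2 (depth j) %| adic_phase u' (depth j) + (- adic_phase u (depth j))%R)%int].
have mD : measurable D.
  exact: (measurable_phase_pred (depth j) [set e | (pow2 (depth j) %| e%:Z + _)%int]).
have D1 : (unif R D <= (hpow (depth j))%:E)%E by exact: unif_divisible.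
apply: le_lt_trans small; apply: le_trans D1.
have <- : P (setT `*` D) = unif R D by rewrite product_measure1E//= probability_setT mul1e.
rewrite coded_lawE; apply: le_measure; rewrite ?inE.
- apply: (measurable_coded_set lam modulus v0 m mpr bO).
  exact: measurable_mclosed_ball.
- exact: measurableX.
move=> [x' u'] /= close; split => //.
have := @coded_close j 0 x u x' u' lj close.
by rewrite subr0 -rpredN opprB.
Qed.

(** A return at distance 2^-(scale j) shifts the phase by a multiple of
2^(depth j), which exceeds the allowed time. *)
Lemma coded_law_recur a n : nu (recur_set d T a n) = 0%E.
Proof.
apply: (@coded_law_null (maxn a n)).
  apply: (@borel_closed X); apply: closed_recur_set => //.
  by apply: (lipschitz_continuous dc); exists (2 ^+ lam).
move=> j x u; rewrite geq_max => /andP[aj nj] lj.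
move=> /(_ (scale j) (leq_trans nj (scale_ge _ _ j lam0)))[k /andP[k0 ka] close].
have := @coded_close j k x u x u lj close.
rewrite opprB addrC subrK.
have -> : pow2 (depth j) = (2 ^ depth j)%N%:Z by rewrite /pow2 -natz natrX.
rewrite dvdzE /= => /dvdn_leq -/(_ k0) /leq_trans -/(_ _ ka).
rewrite leq_exp2l// leqNgt => /negP; apply.
by apply: leq_ltn_trans (scale_lt_depth lam modulus v0 j); rewrite leq_mul2l aj orbT.
Qed.

End coding_reading.

(** * Approximation of an arbitrary invariant measure *)

Lemma Rintegral_distribution (R : realType) d d' (T : measurableType d)
    (T' : measurableType d') (P : probability T R) (Q : probability T' R)
    (X : T -> T') (f : T' -> R) (C : R) :
  measurable_fun setT X -> measurable_fun setT f -> (forall y, `|f y| <= C) ->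
  (forall A, measurable A -> Q A = P (X @^-1` A)) ->
  \int[Q]_y f y = \int[P]_x f (X x).
Proof.
move=> mX mf fC QE; congr fine.
have mfE : measurable_fun setT (EFin \o f) by exact/measurable_EFinP.
rewrite (@eq_measure_integral _ _ _ _ (pushforward P X)); last first.
  by move=> A mA _; exact: QE.
rewrite (@integral_pushforward _ _ _ _ _ X mX P setT (EFin \o f))//.
by apply: (@bounded_integrable _ _ _ P _ C) => //; exact: measurableT_comp.
Qed.

Section approximation.
Context (R : realType) (M : completeMetricType R).
Local Notation X := (bilateral_product M).
Local Notation T := (@full_shift M).
Local Notation MT := (invariant_probability R T).

(** Divisibility by 2^n for infinitely many n is divisibility for all n, which
has probability 0. *)
Lemma ae_eventually_uncoded : {ae unif R, forall u, forall i : int,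
  exists N, forall n, (N <= n)%N -> ~~ (pow2 n %| adic_phase u n + i)%int}.
Proof.
pose D i n := [set u : measurableTypeR R | (pow2 n %| (adic_phase u n + i)%R)%int].
have mD i n : measurable (D i n).
  exact: (measurable_phase_pred n [set e | (pow2 n %| e%:Z + i)%int]).
have null i : (unif R).-negligible (\bigcap_n D i n).
  apply/negligibleP; first exact: bigcapT_measurable.
  apply/eqP; rewrite eq_le measure_ge0 andbT; apply/lee_addgt0Pr => e e0.
  have [n _ ne] := ex_hpow_lt 0 e0; rewrite add0e.
  apply: (@le_trans _ _ (unif R (D i n))).
    by apply: le_measure; rewrite ?inE//; [exact: bigcapT_measurable|move=> u; apply].
  by apply: le_trans (unif_divisible R n i) _; rewrite lee_fin ltW.
have nullN : (unif R).-negligible (\bigcup_k \bigcap_n D (if odd k then k./2%:Z else - k./2%:Z) n).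
  exact: negligible_bigcup.
apply: negligibleS nullN => u /= /existsNP[i /forallNP H].
have [k ik] : exists k, i = if odd k then k./2%:Z else - k./2%:Z.
  have [i0|i0] := leP 0 i.
    by exists (`|i|.*2.+1)%N; rewrite /= odd_double /= uphalf_double; lia.
  by exists (`|i|.*2)%N; rewrite odd_double doubleK; lia.
exists k => // n _; rewrite /D /= -ik.
have /existsNP[n' /not_implyP[nn' /negP/negPn dn']] := H n.
move/(dvd_pow2_trans nn') : dn'.
rewrite (@dvdz_pow2_congr _ _ (adic_phase u n + i))// opprD addrACA subrr addr0.
exact: coherentP (coherent_phase u) nn'.
Qed.

Variables (q : nat -> M) (q_dense : forall y, closure (range q) y).
Variables (lam : nat) (modulus : nat -> nat -> nat) (m : nat -> nat -> M).
Variable O : nat -> set M.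
Hypothesis bO : countable_base O.
Variable mu : MT.
Local Notation coded n := (coded lam (modulus n) n (quantize q n) (m n)).
Local Notation mpr n := (measurable_quantize q n).
Local Notation nu n := (coded_measure lam (modulus n) n (m n) (mpr n) mu bO).
Local Notation P := (prob_of mu \x unif R)%E.

Lemma coded_cvg (x : X) u :
  (forall i : int, exists N, forall n, (N <= n)%N -> ~~ (pow2 n %| adic_phase u n + i)%int) ->
  coded n x u @[n --> \oo] --> x.
Proof.
move=> H; apply: bilateral_cvg => i; have [N HN] := H i.
have : quantize q n (x i) @[n --> \oo] --> x i by exact: quantize_cvg.
apply: cvg_trans; apply: near_eq_cvg; exists N => // n /= Nn.
by rewrite codedE (wordE (coherent_phase u) (J := 0)) //=; exact: HN.
Qed.

Lemma coded_law_cvg f : @bounded_continuous R X f ->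
  (\int[prob_of (nu n)]_x f x) @[n --> \oo] --> \int[prob_of mu]_x f x.
Proof.
move=> [cf [C fC]].
have mf : measurable_fun setT (f : borel X -> R) by exact: continuous_measurable.
have -> : \int[prob_of mu]_x f x = \int[P]_xu f xu.1.
  apply: (@Rintegral_distribution _ _ _ _ _ P _ fst f C) => // A mA.
  have -> : fst @^-1` A = A `*` [set: measurableTypeR R].
    by apply/seteqP; split => [xu|xu []].
  have H : P (A `*` setT) = (prob_of mu A * unif R setT)%E.
    by apply: product_measure1E => //; exact: measurableT.
  by rewrite probability_setT mule1 in H; rewrite -H.
have E n : \int[prob_of (nu n)]_x f x = \int[P]_xu f (coded n xu.1 xu.2).
  apply: (@Rintegral_distribution _ _ _ _ (borel X) P (prob_of (nu n))
    (fun xu : borel X * measurableTypeR R => coded n xu.1 xu.2 : borel X) f C) => //.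
  exact: (measurable_coded lam (modulus n) n (m n) (mpr n) bO).
rewrite (funext E).
apply: (@bounded_cvg_integral _ _ _ P (fun n xu => f (coded n xu.1 xu.2)) _ C).
- move=> n; apply: (measurableT_comp (f := f : borel X -> R)) => //.
  exact: (measurable_coded lam (modulus n) n (m n) (mpr n) bO).
- exact: measurableT_comp.
- by move=> n xu; exact: fC.
have [B [mB B0 HB]] := ae_eventually_uncoded.
exists (setT `*` B); split; first exact: measurableX.
  have H : P (setT `*` B) = (prob_of mu setT * unif R B)%E by exact: product_measure1E.
  by rewrite B0 mule0 in H.
move=> [x u] /= nc; split => //; apply: HB => /= H; apply: nc.
exact: (@cvg_comp _ _ _ (fun n => coded n x u : X) f _ _ _ (coded_cvg (x := x) H) (cf x)).
Qed.

End approximation.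

(** * Density of the coded processes *)

Lemma closure_dense (X : topologicalType) (S : set X) : (forall x, closure S x) -> dense S.
Proof.
move=> cS U [x Ux] oU; rewrite setIC.
by apply: (cS x); exact: open_nbhs_nbhs.
Qed.

Lemma dense_sub (X : topologicalType) (S S' : set X) : S `<=` S' -> dense S -> dense S'.
Proof. by move=> SS' dS U U0 oU; have [x [Ux /SS' Sx]] := dS U U0 oU; exists x. Qed.

Lemma base_dense_sequence (X : ptopologicalType) (C : nat -> set X) :
  countable_base C -> exists q : nat -> X, forall x, closure (range q) x.
Proof.
move=> [_ bC]; exists (fun k => xget point (C k)) => x A /bC[k Ckx CkA].
exists (xget point (C k)); split; first by exists k.
by apply: CkA; apply: (@xgetPex _ point (C k)); exists x.
Qed.

Lemma lipschitz_dyadic (R : realType) (X : topologicalType) (d : X -> X -> R) (f : X -> X) :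
  compatible_metric d -> metric_lipschitz d f ->
  exists2 lam, (0 < lam)%N & forall x y, d (f x) (f y) <= 2 ^+ lam * d x y.
Proof.
move=> dc [L HL]; exists (Num.truncn `|L|).+1 => // x y; apply: le_trans (HL x y) _.
apply: ler_wpM2r; first exact: (cmetric_ge0 dc).
apply: le_trans (ler_norm L) _; apply: le_trans (ltW (truncnS_gt _)) _.
by rewrite -natrX ler_nat; exact: ltnW (ltn_expl _ _).
Qed.

Section density.
Context (R : realType) (M : completeMetricType R).
Local Notation X := (bilateral_product M).
Local Notation T := (@full_shift M).
Local Notation MT := (invariant_probability R T).
Hypothesis M_infinite : infinite_set [set: M].
Variable d : X -> X -> R.
Hypothesis dc : compatible_metric d.

(** The letters are isolated from each other and from F. Those of index below o
are finitely many, so the largest of their moduli serves all of them. *)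
Lemma rigid_alphabet (F : set M) : finite_set F -> F !=set0 ->
  exists (m : nat -> M) (modulus : nat -> nat), [/\ injective m,
    forall y c, F y -> y != m c &
    forall o c (z w : X), (c < o)%N ->
      (forall i : int, (`|i| <= modulus o)%N -> F (z i) \/ exists2 c', (c' < o)%N & z i = m c') ->
      d z w <= hpow (modulus o) -> z 0 = m c ->
      F (w 0) \/ range m (w 0) -> w 0 = m c].
Proof.
move=> fF F0; have [m mP] := discrete_sequence fF M_infinite.
have m_inj : injective m.
  move=> a b ab; have [_ [e e0 H]] := mP b; apply: H.
  by rewrite -ab; apply: ballxx.
have /choice[r rP] : forall c, exists e : R, 0 < e /\
    forall y, F y \/ range m y -> ball (m c) e y -> y = m c.
  move=> c; have [nF [e e0 H]] := mP c; have [e' e'0 H'] := finite_ball_disjoint fF nF.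
  exists (Num.min e e'); split; first by rewrite lt_min e0.
  move=> y [Fy|[k _ <-]] yc.
    by case: (H' y Fy); apply: le_ball yc; rewrite ge_min lexx orbT.
  by rewrite (H k)//; apply: le_ball yc; rewrite ge_min lexx.
pose B o := F `|` m @` [set c' | (c' < o)%N].
have fB o : finite_set (B o).
  by rewrite finite_setU; split => //; apply: finite_image; exact: finite_II.
have B0 o : B o !=set0 by case: F0 => y Fy; exists y; left.
have /choice[a aP] : forall oc : nat * nat, exists a, forall z w : X,
    (forall i : int, (`|i| <= a)%N -> B oc.1 (z i)) ->
    d z w <= hpow a -> z 0 = m oc.2 -> ball (m oc.2) (r oc.2) (w 0).
  move=> [ o c]; exact: (isolated_modulus dc (m c) (fB o) (B0 o) (rP c).1).
exists m, (fun o => \max_(c < o) a (o, (c : nat))); split => //.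
  by move=> y c Fy; apply/eqP => ym; case: (mP c) => + _; apply; rewrite -ym.
move=> o c z w co zB zw z0 w0; apply: (rP c).2 => //.
have ac : (a (o, c) <= \max_(c < o) a (o, (c : nat)))%N.
  exact: (@leq_bigmax _ (fun c : 'I_o => a (o, (c : nat))) (Ordinal co)).
apply: (aP (o, c) z w) => //=.
  move=> i /leq_trans/(_ ac)/zB [Fz|[c' c'o zc]]; first by left.
  by right; exists c'.
by apply: le_trans zw _; rewrite ler_hpow.
Qed.

Variable O : nat -> set M.
Hypothesis bO : countable_base O.
Hypothesis shift_lipschitz : metric_lipschitz d T.

Lemma dense_pinfty : dense [set mu : MT |
  (forall a n, prob_of mu (thick d (prob_of mu) a n) = 0%E) /\
  (forall a n, prob_of mu (recur_set d T a n) = 0%E)].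
Proof.
have [q qd] := base_dense_sequence bO.
have [lam lam0 HT] := lipschitz_dyadic dc shift_lipschitz.
have /choice[m mP] : forall n, exists m, exists modulus, [/\ injective m,
    forall y c, range (quantize q n) y -> y != m c &
    forall o c (z w : X), (c < o)%N ->
      (forall i : int, (`|i| <= modulus o)%N -> range (quantize q n) (z i) \/
         exists2 c', (c' < o)%N & z i = m c') ->
      d z w <= hpow (modulus o) -> z 0 = m c ->
      range (quantize q n) (w 0) \/ range m (w 0) -> w 0 = m c].
  move=> n; apply: rigid_alphabet; first exact: finite_quantize.
  by exists (quantize q n point); exists point.
have /choice[modulus modulusP] := mP.
apply: closure_dense => mu; pose nu n := coded_measure lam (modulus n) n (m n)
  (measurable_quantize q n) mu bO.
apply: (@weak_limit_closure R X T _ mu nu); last first.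
  by move=> f cf; exact: coded_law_cvg.
move=> n; have [mi mF rigid] := modulusP n.
have mF' y c : quantize q n y != m n c by apply: mF; exists y.
split => a k.
  exact: (@coded_law_thick _ _ d lam (modulus n) n dc lam0 HT).
exact: (@coded_law_recur _ _ d lam (modulus n) n dc lam0 HT).
Qed.

End density.

Theorem theorem1p2 (R : realType) (M : completeMetricType R)
    (M_separable : separable M) (M_infinite : infinite_set [set: M])
    (d : bilateral_product M -> bilateral_product M -> R)
    (d_compatible : compatible_metric d)
    (shift_lipschitz : metric_lipschitz d (@full_shift M)) :
  let MT := invariant_probability R (@full_shift M) in
  let S1 := [set mu : MT | has_packing_dim d (prob_of mu) +oo%E] in
  let S2 := [set mu : MT | {ae prob_of mu, forall x : borel (bilateral_product M),
      upper_recurrence_rate d (@full_shift M) x = +oo%E}] in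
  let S3 := [set mu : MT | {ae (prob_of mu \x prob_of mu)%E,
      forall xy : borel (bilateral_product M) * borel (bilateral_product M),
      upper_waiting_time_indicator d (@full_shift M) xy.1 xy.2 = +oo%E}] in
  [/\ Gdelta S1 /\ dense S1, Gdelta S2 /\ dense S2 & residual S3].
Proof.
move=> MT S1 S2 S3.
have [ O bO] := metric_countable_base M_separable.
have bC := box_base_countable_base bO.
have cT := lipschitz_continuous d_compatible shift_lipschitz.
have dS := dense_pinfty M_infinite d_compatible bO shift_lipschitz.
have G1 : Gdelta S1 by exact: (Gdelta_packing_pinfty _ d_compatible bC).
have G2 : Gdelta S2 by exact: (Gdelta_recurrence_pinfty d_compatible cT).
have D1 : dense S1.
  apply: dense_sub _ dS => mu [H _]; exact/(has_packing_dim_pinftyP d_compatible bC).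
have D2 : dense S2.
  apply: dense_sub _ dS => mu [_ H]; exact/(ae_recurrence_pinftyP d_compatible cT).
split => //; exists S1; first exact: Gdelta_dense_of.
by move=> mu; apply: packing_pinfty_waiting bC _.
Qed.
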